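(* Let $I\subseteq P=\Bbbk[x_1,\dots,x_n]$ be a non-zero homogeneous ideal, where $\Bbbk$ is a sufficiently large field (i.e. large enough that $I$ possesses, after some linear change of coordinates over $\Bbbk$, a finite Pommaret basis for the degree reverse lexicographic order; any infinite field is). Then the Castelnuovo-Mumford regularity of $I$ is $q$ if and only if $I$ has in some coordinates a homogeneous Pommaret basis of degree $q$ with respect to the degree reverse lexicographic order.
   Context: ''In some coordinates'' means after a linear change of variables $\tilde{\mathbf{x}}=A\mathbf{x}$ with a regular matrix $A\in\Bbbk^{n\times n}$, the polynomials being rewritten in $\tilde x_1,\dots,\tilde x_n$ and their new exponent vectors being sorted by the same order. Degree reverse lexicographic order: $x^\mu\prec x^\nu$ iff $|\mu|<|\nu|$, or $|\mu|=|\nu|$ and the first non-vanishing entry of $\mu-\nu$ is positive (so $x_1\prec\dots\prec x_n$). The class of $\mu\in\mathbb{N}_0^n$ is $\mathrm{cls}\,\mu=\min\{i\mid\mu_i\ne0\}$, with $\mathrm{cls}\,0=n$; the Pommaret cone of $\mu$ is $C_P(\mu)=\{\mu+\rho\mid\rho\in\mathbb{N}_0^n,\ \rho_j=0\text{ for all }j>\mathrm{cls}\,\mu\}$. A Pommaret basis of $I$ is a finite set $H\subset I\setminus\{0\}$ with pairwise distinct leading exponents such that $\{\mathrm{le}_\prec f\mid0\ne f\in I\}$ ($\mathrm{le}_\prec f$ the leading exponent) is the disjoint union of the cones $C_P(\mathrm{le}_\prec h)$, $h\in H$; its degree is $\max_{h\in H}\deg h$. The homogeneous ideal $I$ is $q$-regular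 if for every $i\ge0$ its $i$th syzygy module (the $i$th module in the minimal graded free resolution of $I$, with $i=0$ referring to the generators of $I$) is generated by elements of degree less than or equal to $q+i$; the Castelnuovo-Mumford regularity $\mathrm{reg}\,I$ is the least $q$ for which $I$ is $q$-regular. *)

(* Defs.v *)
From mathcomp Require Export all_boot all_order all_algebra.
From mathcomp.multinomials Require Export mpoly.

Set Implicit Arguments.
Unset Strict Implicit.
Unset Printing Implicit Defensive.

Import GRing.Theory.

Local Open Scope ring_scope.

(* The library's [idealr] only covers proper decidable ideals; here the unit
   ideal and undecidable ideals are allowed. *)
Record homogeneous_ideal (k : fieldType) (n : nat)
    (I : {mpoly k[n]} -> Prop) : Prop := HomogeneousIdeal {
  hideal0 : I 0;
  hidealD : forall f g, I f -> I g -> I (f + g);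
  hidealM : forall f g, I g -> I (f * g);
  hideal_component : forall (d : nat) f, I f -> I (pihomog mdeg d f)
}.

(* The ideal I written in the coordinates y = A x: the polynomials g in the
   variables y such that g(A x) belongs to I. *)
Definition in_coords (k : fieldType) (n : nat) (A : 'M[k]_n)
    (I : {mpoly k[n]} -> Prop) : {mpoly k[n]} -> Prop :=
  fun g => I (g \mPo [tuple \sum_(j < n) A i j *: 'X_j | i < n]).

(* Degree reverse lexicographic order with x_1 < ... < x_n. The library's order
   on 'X_{1..n} compares the first differing exponents the other way round. *)
Definition drl_lt (n : nat) (m1 m2 : 'X_{1..n}) : bool :=
  (mdeg m1 < mdeg m2)%N ||
  (mdeg m1 == mdeg m2) &&
  [exists i : 'I_n, (m2 i < m1 i)%N &&
                    [forall j : 'I_n, (j < i)%N ==> (m1 j == m2 j)]].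

(* The drl-largest exponent of f; 0 is the smallest exponent, so it is only a
   default value, for f = 0. *)
Definition drl_lead (k : fieldType) (n : nat) (f : {mpoly k[n]}) : 'X_{1..n} :=
  foldr (fun m1 m2 => if drl_lt m2 m1 then m1 else m2) 0%MM (msupp f).

(* Classes are numbered from 1 to n, so the variable x_i of index i : 'I_n has
   number i.+1. *)
Definition cls (n : nat) (m : 'X_{1..n}) : nat :=
  if m == 0%MM then n else (find (fun e : nat => e != 0%N) m).+1.

Definition pommaret_cone (n : nat) (m nu : 'X_{1..n}) : Prop :=
  exists2 rho : 'X_{1..n},
    nu = (m + rho)%MM & forall j : 'I_n, (cls m < j.+1)%N -> rho j = 0%N.

Record pommaret_basis (k : fieldType) (n : nat) (I : {mpoly k[n]} -> Prop)
    (H : seq {mpoly k[n]}) : Prop := PommaretBasis {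
  pommaret_sub : forall h, h \in H -> I h /\ h != 0;
  pommaret_inj : {in H &, injective (@drl_lead k n)};
  pommaret_cover : forall m : 'X_{1..n},
    (exists f, [/\ I f, f != 0 & drl_lead f = m]) <->
    (exists2 h, h \in H & pommaret_cone (drl_lead h) m);
  pommaret_disjoint : forall h1 h2, h1 \in H -> h2 \in H -> h1 != h2 ->
    forall m, ~ (pommaret_cone (drl_lead h1) m /\ pommaret_cone (drl_lead h2) m)
}.

(* msize is 1 + the degree. *)
Definition basis_degree (k : fieldType) (n : nat) (H : seq {mpoly k[n]}) : nat :=
  \max_(h <- H) (msize h).-1.

(* A graded free module of rank r, whose j-th basis vector has degree d j, is
   represented by its row vectors; v is homogeneous of degree e in it. *)
Definition homog_vec (k : fieldType) (n r : nat) (d : 'I_r -> nat) (e : nat)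
    (v : 'rV[{mpoly k[n]}]_r) : Prop :=
  forall j : 'I_r,
    if (d j <= e)%N then v 0 j \is (e - d j).-homog else v 0 j == 0.

(* Every element is a linear combination of homogeneous elements of degree at
   most m. *)
Definition generated_in_degree_le (k : fieldType) (n r : nat) (d : 'I_r -> nat)
    (m : nat) : Prop :=
  forall v : 'rV[{mpoly k[n]}]_r,
    exists (s : nat) (G : 'M[{mpoly k[n]}]_(s, r)) (c : 'rV[{mpoly k[n]}]_s),
      (forall a : 'I_s, exists2 e, (e <= m)%N & homog_vec d e (row a G))
      /\ v = c *m G.

(* ... -> F_2 -> F_1 -> F_0 -> I -> 0 with F_i of rank fr_rank i. Maps act on
   row vectors by right multiplication: fr_aug is F_0 -> I and fr_map i is
   F_(i+1) -> F_i. Minimality: fr_map i has its image in (x_1, ..., x_n) F_i.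
   Natural numbers suffice for the degrees, as I lives in degrees >= 0 and the
   resolution is minimal. *)
Record minimal_graded_free_resolution (k : fieldType) (n : nat)
    (I : {mpoly k[n]} -> Prop) : Type := MinimalGradedFreeResolution {
  fr_rank : nat -> nat;
  fr_deg : forall i, 'I_(fr_rank i) -> nat;
  fr_aug : 'cV[{mpoly k[n]}]_(fr_rank 0);
  fr_map : forall i, 'M[{mpoly k[n]}]_(fr_rank i.+1, fr_rank i);
  fr_aug_homog : forall a, fr_aug a 0 \is (fr_deg a).-homog;
  fr_map_homog : forall i a, homog_vec (@fr_deg i) (fr_deg a) (row a (fr_map i));
  fr_aug_image : forall f, I f <->
    exists v : 'rV[{mpoly k[n]}]_(fr_rank 0), f = (v *m fr_aug) 0 0;
  fr_exact0 : forall v : 'rV[{mpoly k[n]}]_(fr_rank 0),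
    v *m fr_aug = 0 <->
    exists w : 'rV[{mpoly k[n]}]_(fr_rank 1), v = w *m fr_map 0;
  fr_exact : forall i (v : 'rV[{mpoly k[n]}]_(fr_rank i.+1)),
    v *m fr_map i = 0 <->
    exists w : 'rV[{mpoly k[n]}]_(fr_rank i.+2), v = w *m fr_map i.+1;
  fr_minimal : forall i a b, (fr_map i a b)@_0%MM = 0
}.

(* The minimal graded free resolution is unique up to isomorphism, so any one
   of them can be used. *)
Definition q_regular (k : fieldType) (n : nat) (I : {mpoly k[n]} -> Prop)
    (q : nat) : Prop :=
  exists F : minimal_graded_free_resolution I,
    forall i : nat, generated_in_degree_le k n (@fr_deg _ _ _ F i) (q + i).

Definition castelnuovo_mumford_regularity (k : fieldType) (n : nat)
    (I : {mpoly k[n]} -> Prop) (q : nat) : Prop :=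
  q_regular I q /\ forall q' : nat, q_regular I q' -> (q <= q')%N.

(* Main.v *)
(* Let H be a finite Pommaret basis of I in coordinates y_1, ..., y_n. It has
   degree at most q iff, for all j, multiplication by y_{j+1} on
   P/(I, y_1, ..., y_j) is injective in degrees >= q: an element h of H of class
   j+1 is, modulo y_1, ..., y_j, divisible by y_{j+1}, and the quotient is a
   nonzero element killed by y_{j+1} in degree deg h - 1; conversely the leading
   exponent of an element killed by y_{j+1}, multiplied by y_{j+1}, is that of an
   element of H. Viewing the Koszul complex as an iterated mapping cone, this
   injectivity amounts to the vanishing of H_i(y; P/I), i > 0, in degrees >= q + i.
   Shifting dimensions along 0 -> N -> F -> M -> 0 with F free turns this into the
   vanishing of H_0 of the successive syzygy modules of I, that is, by Nakayama's
   lemma, into the bounds q + i on the degrees of their generators. So every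
   Pommaret basis has the regularity as its degree. *)
From Stdlib Require Import Classical IndefiniteDescription.
Require Import Defs.

Set Implicit Arguments.
Unset Strict Implicit.
Unset Printing Implicit Defensive.

Import GRing.Theory.

Local Open Scope ring_scope.

(** * Koszul homology *)

(** Ideals and submodules are undecidable predicates, so no quotient is formed: the homology of
    [U/Z] is expressed by chains with entries in [U] and equations up to entries in [Z]. Degrees are
    measured on the entries of a chain. Entry degree at least q in homological degree i is total
    degree at least q + i, so one and the same bound q serves for all i. The vanishing of the
    homology of all n linear forms is insensitive to the choice of coordinates, whereas injectivity
    of the successive multiplications is not. Vanishing alone therefore cannot give injectivity
    back: a descent must start in some degree from which injectivity is already known, and the
    finite basis [H] supplies one. A change of coordinates affects the sequence only: [I] and its
    resolution stay fixed, while the new variables are read as linear forms in the old ones. *)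

Definition zero_sub (V : zmodType) (t : nat) (v : V) : Prop := 0 = v.

Section Koszul.

Variables (R : comNzRingType) (y : nat -> R).

(** One copy of V for each subset of the first j elements, the second half belonging to the subsets
    that contain the last one. Chains of all homological degrees live together ([hdeg] selects
    them), and the differential is literally that of a mapping cone. *)
Fixpoint koszul (V : lmodType R) (j : nat) : lmodType R :=
  if j is j'.+1 then (koszul V j' * koszul V j')%type else V.

Section Chains.

Variable V : lmodType R.

Fixpoint kdiff j : koszul V j -> koszul V j :=
  if j is j'.+1 then
    fun c => (kdiff c.1 + y j' *: c.2, - kdiff c.2)
  else fun=> 0.

Fixpoint all_entries (S : V -> Prop) j : koszul V j -> Prop :=
  if j is j'.+1 then fun c => all_entries S c.1 /\ all_entries S c.2 else S.

Fixpoint hdeg j i : koszul V j -> Prop :=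
  match j with
  | j'.+1 => fun c =>
      hdeg i c.1 /\ (if i is i'.+1 then hdeg i' c.2 else c.2 = 0)
  | 0%N => fun c => if i is 0%N then True else c = 0
  end.

Fixpoint embed0 j (v : V) : koszul V j :=
  if j is j'.+1 then (embed0 j' v, 0) else v.

Fixpoint embed1 j (u : nat -> V) : koszul V j :=
  if j is j'.+1 then (embed1 j' u, embed0 j' (u j')) else 0.

Lemma kdiff_lin j a (b c : koszul V j) :
  kdiff (a *: b + c) = a *: kdiff b + kdiff c.
Proof.
elim: j b c => [|j IH] /= b c; first by rewrite scaler0 addr0.
apply: injective_projections; rewrite /= !IH; last by rewrite opprD scalerN.
by rewrite !scalerDr !scalerA mulrC addrACA.
Qed.

Lemma kdiff0 j : kdiff (0 : koszul V j) = 0.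
Proof. by have := kdiff_lin (-1) (0 : koszul V j) 0; rewrite addr0 scaler0 scaleN1r addNr. Qed.

Lemma kdiffD j (b c : koszul V j) : kdiff (b + c) = kdiff b + kdiff c.
Proof. by rewrite -[b]scale1r kdiff_lin !scale1r. Qed.

Lemma kdiffZ j a (b : koszul V j) : kdiff (a *: b) = a *: kdiff b.
Proof. by rewrite -[a *: b]addr0 kdiff_lin kdiff0 addr0. Qed.

Lemma kdiffN j (b : koszul V j) : kdiff (- b) = - kdiff b.
Proof. by rewrite -scaleN1r kdiffZ scaleN1r. Qed.

Lemma kdiffB j (b c : koszul V j) : kdiff (b - c) = kdiff b - kdiff c.
Proof. by rewrite kdiffD kdiffN. Qed.

Lemma kdiffK j (c : koszul V j) : kdiff (kdiff c) = 0.
Proof.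
elim: j c => [//|j IH] [a b]; apply: injective_projections => /=.
  by rewrite kdiffD kdiffZ IH add0r scalerN subrr.
by rewrite kdiffN IH !oppr0.
Qed.

Lemma hdeg_lin j i a (b c : koszul V j) :
  hdeg i b -> hdeg i c -> hdeg i (a *: b + c).
Proof.
elim: j i b c => [|j IH] [|i] /= b c //.
- by move=> -> ->; rewrite scaler0 addr0.
- by move=> [hb ->] [hc ->]; split; [exact: IH | rewrite scaler0 addr0].
- by move=> [hb hb'] [hc hc']; split; exact: IH.
Qed.

Lemma hdeg0 j i : hdeg i (0 : koszul V j).
Proof. by elim: j i => [|j IH] [|i] /=. Qed.

Lemma hdegD j i (b c : koszul V j) : hdeg i b -> hdeg i c -> hdeg i (b + c).
Proof. by move=> hb hc; rewrite -[b]scale1r; apply: hdeg_lin. Qed.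

Lemma hdegZ j i a (b : koszul V j) : hdeg i b -> hdeg i (a *: b).
Proof. by move=> hb; rewrite -[a *: b]addr0; apply: hdeg_lin => //; exact: hdeg0. Qed.

Lemma hdegN j i (b : koszul V j) : hdeg i b -> hdeg i (- b).
Proof. by rewrite -scaleN1r; exact: hdegZ. Qed.

Lemma hdegB j i (b c : koszul V j) : hdeg i b -> hdeg i c -> hdeg i (b - c).
Proof. by move=> hb hc; apply: hdegD => //; exact: hdegN. Qed.

Lemma kdiff_hdeg0 j (c : koszul V j) : hdeg 0 c -> kdiff c = 0.
Proof.
elim: j c => //= j IH c [h1 ->].
by rewrite IH // kdiff0 scaler0 addr0 oppr0.
Qed.

Lemma hdeg_kdiff j i (c : koszul V j) : hdeg i.+1 c -> hdeg i (kdiff c).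
Proof.
elim: j i c => [|j IH] [|i] //= c [h1 h2].
  by split; [apply: hdegD; [exact: IH | exact: hdegZ] | rewrite kdiff_hdeg0 ?oppr0].
split; first by apply: hdegD; [exact: IH | exact: hdegZ].
by apply: hdegN; exact: IH.
Qed.

Definition subgroup (S : V -> Prop) := S 0 /\ forall u v, S u -> S v -> S (u - v).

Lemma all_entries0 S j : subgroup S -> all_entries S (0 : koszul V j).
Proof. by move=> [S0 _]; elim: j => [|j IH] /=. Qed.

Lemma all_entriesB S j (b c : koszul V j) : subgroup S ->
  all_entries S b -> all_entries S c -> all_entries S (b - c).
Proof.
move=> [_ SB]; elim: j b c => [|j IH] /= b c; first exact: SB.
by move=> [b1 b2] [c1 c2]; split; exact: IH.
Qed.

Lemma all_entriesN S j (c : koszul V j) : subgroup S ->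
  all_entries S c -> all_entries S (- c).
Proof. by move=> Sg Sc; rewrite -[- c]add0r; apply: all_entriesB => //; exact: all_entries0. Qed.

Lemma all_entriesD S j (b c : koszul V j) : subgroup S ->
  all_entries S b -> all_entries S c -> all_entries S (b + c).
Proof.
by move=> Sg Sb Sc; rewrite -[c]opprK; apply: all_entriesB => //; exact: all_entriesN.
Qed.

Lemma all_entries_sub (S T : V -> Prop) j (c : koszul V j) :
  (forall v, S v -> T v) -> all_entries S c -> all_entries T c.
Proof. by move=> ST; elim: j c => [|j IH] /= c; [exact: ST | case; split; exact: IH]. Qed.

Lemma all_entries_I (S T : V -> Prop) j (c : koszul V j) :
  all_entries S c -> all_entries T c -> all_entries (fun v => S v /\ T v) c.
Proof. by elim: j c => [|j IH] //= c [? ?] [? ?]; split; exact: IH. Qed.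

Lemma all_entriesZ (S T : V -> Prop) j a (c : koszul V j) :
  (forall v, S v -> T (a *: v)) -> all_entries S c -> all_entries T (a *: c).
Proof. by move=> ST; elim: j c => [|j IH] /= c; [exact: ST | case; split; exact: IH]. Qed.

Lemma all_entries_eq0 j (c : koszul V j) : all_entries (eq 0) c -> c = 0.
Proof. by elim: j c => [c <-|j IH] //= [a b] /= [/IH -> /IH ->]. Qed.

Lemma all_entries_kdiff (S T : V -> Prop) j (c : koszul V j) :
  subgroup T -> (forall i v, S v -> T (y i *: v)) ->
  all_entries S c -> all_entries T (kdiff c).
Proof.
move=> Tg ST; elim: j c => [|j IH] /= c; first by case: Tg.
move=> [h1 h2]; split; last by apply: all_entriesN => //; exact: IH.
by apply: all_entriesD => //; [exact: IH | apply: all_entriesZ h2 => v; exact: ST].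
Qed.

Lemma embed0_hdeg j v : hdeg 0 (embed0 j v).
Proof. by elim: j => [|j IH] /=. Qed.

Lemma hdeg0P j (c : koszul V j) : hdeg 0 c -> exists v, c = embed0 j v.
Proof.
elim: j c => [|j IH] /= c; first by exists c.
by case: c => a b /= [/IH [v ->] ->]; exists v.
Qed.

Lemma all_entries_embed0 S j v : subgroup S -> all_entries S (embed0 j v) <-> S v.
Proof.
move=> Sg; elim: j => [|j IH] //=; rewrite IH; split=> [[]|] // Sv; split=> //.
exact: all_entries0.
Qed.

Lemma embed0_lin j a u v : embed0 j (a *: u + v) = a *: embed0 j u + embed0 j v.
Proof.
elim: j => [|j IH] //=; rewrite IH; apply: injective_projections => //=.
by rewrite scaler0 addr0.
Qed.

Lemma embed0_0 j : embed0 j 0 = 0.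
Proof. by elim: j => [|j IH] //=; rewrite IH. Qed.

Lemma embed0ZB j a u v : embed0 j (a *: u - v) = a *: embed0 j u - embed0 j v.
Proof.
by rewrite embed0_lin -[- v]addr0 -scaleN1r embed0_lin embed0_0 addr0 scaleN1r.
Qed.

Lemma embed1_hdeg j u : hdeg 1 (embed1 j u).
Proof. by elim: j => [|j IH] //=; split=> //; exact: embed0_hdeg. Qed.

Lemma eq_embed1 j (u w : nat -> V) :
  (forall i, (i < j)%N -> u i = w i) -> embed1 j u = embed1 j w.
Proof.
elim: j => [|j IH] //= uw; rewrite uw // IH // => i ij.
by apply: uw; rewrite ltnS ltnW.
Qed.

Lemma hdeg1P j (c : koszul V j) : hdeg 1 c -> exists u, c = embed1 j u.
Proof.
elim: j c => [|j IH] /= c; first by move=> ->; exists (fun=> 0).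
case: c => a b /= [/IH [u ->] /hdeg0P [v ->]].
exists (fun i => if i == j then v else u i); rewrite eqxx; congr (_, _).
by apply: eq_embed1 => i ij; rewrite ltn_eqF.
Qed.

Lemma all_entries_embed1 S j u : subgroup S ->
  all_entries S (embed1 j u) <-> (forall i, (i < j)%N -> S (u i)).
Proof.
move=> Sg; elim: j => [|j IH] /=; first by split=> // _; case: Sg.
rewrite IH all_entries_embed0 //; split=> [[h1 h2] i|h].
  by rewrite ltnS leq_eqVlt => /orP [/eqP -> //|]; exact: h1.
by split=> [i ij|]; apply: h; rewrite // ltnS ltnW.
Qed.

Lemma kdiff_embed1 j u :
  kdiff (embed1 j u) = embed0 j (\sum_(i < j) y i *: u i).
Proof.
elim: j => [|j IH] /=; first by rewrite big_ord0.
rewrite IH big_ord_recr /= (kdiff_hdeg0 (embed0_hdeg _ _)) oppr0; congr (_, _).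
by rewrite [in RHS]addrC embed0_lin addrC.
Qed.

End Chains.

(** * Koszul homology of a graded quotient U/Z *)

Section Homology.

Variables (V : lmodType R) (U Z : nat -> V -> Prop).
Hypothesis Ug : forall t, subgroup (U t).
Hypothesis Zg : forall t, subgroup (Z t).
Hypothesis Uy : forall t i v, U t v -> U t.+1 (y i *: v).
Hypothesis Zy : forall t i v, Z t v -> Z t.+1 (y i *: v).

(* [U t] and [Z t] are the elements of degree t - 1, where degree -1 stands for
   the zero space, so that boundaries exist in every degree. *)
Definition hvanish j i t := forall c : koszul V j,
  hdeg i c -> all_entries (U t.+1) c -> all_entries (Z t.+2) (kdiff c) ->
  exists b, [/\ hdeg i.+1 b, all_entries (U t) b
              & all_entries (Z t.+1) (c - kdiff b)].

(** Injectivity of multiplication by [y j], from degree t to t + 1, on the i-th homology of the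
    first j elements. For i = 0 this is [regular_at], where the quotient by these elements is
    spelled out with cofactors. *)
Definition hinj j i t := forall c : koszul V j,
  hdeg i c -> all_entries (U t.+1) c -> all_entries (Z t.+2) (kdiff c) ->
  (exists b, [/\ hdeg i.+1 b, all_entries (U t.+1) b
               & all_entries (Z t.+2) (y j *: c - kdiff b)]) ->
  exists b, [/\ hdeg i.+1 b, all_entries (U t) b
              & all_entries (Z t.+1) (c - kdiff b)].

Definition regular_at j t := forall (v : V) (u : nat -> V),
  U t.+1 v -> (forall i, (i < j)%N -> U t.+1 (u i)) ->
  Z t.+2 (y j *: v - \sum_(i < j) y i *: u i) ->
  exists2 w : nat -> V, forall i, (i < j)%N -> U t (w i)
                      & Z t.+1 (v - \sum_(i < j) y i *: w i).

(** Exactness of H_(i+1)(j) -> H_(i+1)(j+1) -> H_i(j) -> H_i(j), the last map being multiplication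
    by [y j]: the second half of a cycle is a class killed by this map. *)
Lemma hvanish_cone j i t :
  hvanish j i.+1 t -> hinj j i t -> hvanish j.+1 i.+1 t.
Proof.
move=> van inj [a b] /= [ha hb] [Ua Ub] [Zda Zdb].
have {}Zdb : all_entries (Z t.+2) (kdiff b).
  by rewrite -[kdiff b]opprK; exact: all_entriesN.
have [|b' [hb' Ub' Zb']] := inj b hb Ub Zdb.
  exists (- a); split; [exact: hdegN | exact: all_entriesN |].
  by rewrite kdiffN opprK addrC.
have [||| a' [ha' Ua' Za']] := van (a + y j *: b').
- by apply: hdegD => //; exact: hdegZ.
- by apply: all_entriesD => //; apply: all_entriesZ Ub' => v; exact: Uy.
- rewrite kdiffD kdiffZ.
  have -> : kdiff a + y j *: kdiff b' =
            (kdiff a + y j *: b) - y j *: (b - kdiff b').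
    by rewrite scalerBr opprB addrAC addrCA addrA subrK addrC.
  by apply: all_entriesB => //; apply: all_entriesZ Zb' => v; exact: Zy.
exists (a', - b'); split=> /=.
- by split=> //; exact: hdegN.
- by split=> //; exact: all_entriesN.
split; last by rewrite kdiffN opprK.
by rewrite scalerN opprB addrA.
Qed.

(** If [y j *: c] is the boundary of b, then (- b, c) is a cycle of the cone; the second half of a
    chain that it bounds exhibits c as a boundary. *)
Lemma hinj_cone j i t : hvanish j.+1 i.+1 t -> hinj j i t.
Proof.
move=> van c hc Uc Zc [b [hb Ub Zb]].
have [|||[a' b'] /= [[ha' hb'] [Ua' Ub'] [Z1 Z2]]] := van (- b, c).
- by split=> //=; exact: hdegN.
- by split=> //=; exact: all_entriesN.
- split=> /=; last exact: all_entriesN.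
  by rewrite kdiffN addrC.
exists (- b'); split; [exact: hdegN | exact: all_entriesN |].
by rewrite kdiffN.
Qed.

Lemma hvanish_inj j i t : hvanish j i t -> hinj j i t.
Proof. by move=> van c hc Uc Zc _; exact: van. Qed.

(** The multiple [y j *: c] is a cycle one degree higher, hence a boundary, and injectivity brings
    this down to c. *)
Lemma hvanish_pred j i t : hinj j i t -> hvanish j i t.+1 -> hvanish j i t.
Proof.
move=> inj van c hc Uc Zc; apply: inj => //; apply: van.
- exact: hdegZ.
- by apply: all_entriesZ Uc => v; exact: Uy.
- by rewrite kdiffZ; apply: all_entriesZ Zc => v; exact: Zy.
Qed.

Lemma hvanish0S i t : hvanish 0 i.+1 t.
Proof.
move=> c /= -> _ _; exists 0; split=> //; first by case: (Ug t).
by rewrite subrr; case: (Zg t.+1).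
Qed.

Lemma hinj0P j t : hinj j 0 t <-> regular_at j t.
Proof.
have E (v : V) (u : nat -> V) a : a *: embed0 j v - kdiff (embed1 j u) =
    embed0 j (a *: v - \sum_(i < j) y i *: u i).
  by rewrite kdiff_embed1 embed0ZB.
split=> [inj v u Uv Uu Zvu|reg c /hdeg0P [v ->] /all_entries_embed0 Uv _].
  have [||||b [/hdeg1P [w ->] /all_entries_embed1 Uw Zw]] := inj (embed0 j v).
  - exact: embed0_hdeg.
  - exact/all_entries_embed0.
  - by rewrite (kdiff_hdeg0 (embed0_hdeg _ _)); exact: all_entries0.
  - exists (embed1 j u); split; first exact: embed1_hdeg.
      exact/all_entries_embed1.
    by rewrite E; apply/all_entries_embed0.
  exists w; first exact: Uw.
  by move: Zw; rewrite -[embed0 j v]scale1r E scale1r; move/all_entries_embed0; exact.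
move=> [b [/hdeg1P [u ->] /all_entries_embed1 Uu]].
rewrite E => /all_entries_embed0 Zu.
have [w Uw Zw] := reg v u (Uv (Ug _)) (Uu (Ug _)) (Zu (Zg _)).
exists (embed1 j w); split; first exact: embed1_hdeg.
  exact/all_entries_embed1.
by rewrite -[embed0 j v]scale1r E scale1r; exact/all_entries_embed0.
Qed.

Lemma hvanish00P j t : hvanish j 0 t <-> forall v, U t.+1 v ->
  exists2 w : nat -> V, forall i, (i < j)%N -> U t (w i)
                      & Z t.+1 (v - \sum_(i < j) y i *: w i).
Proof.
have E (v : V) (u : nat -> V) : embed0 j v - kdiff (embed1 j u) =
    embed0 j (v - \sum_(i < j) y i *: u i).
  by rewrite kdiff_embed1 -[v in RHS]scale1r embed0ZB scale1r.
split=> [van v Uv|gen c /hdeg0P [v ->] /all_entries_embed0 Uv _].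
  have [|||b [/hdeg1P [w ->] /all_entries_embed1 Uw Zw]] := van (embed0 j v).
  - exact: embed0_hdeg.
  - exact/all_entries_embed0.
  - by rewrite (kdiff_hdeg0 (embed0_hdeg _ _)); exact: all_entries0.
  exists w; first exact: Uw.
  by move: Zw; rewrite E; move/all_entries_embed0; exact.
have [w Uw Zw] := gen v (Uv (Ug _)).
exists (embed1 j w); split; first exact: embed1_hdeg.
  exact/all_entries_embed1.
by rewrite E; exact/all_entries_embed0.
Qed.

Lemma hvanish_of_regular n q :
  (forall j t, (j < n)%N -> (q <= t)%N -> regular_at j t) ->
  forall j i t, (j <= n)%N -> (q <= t)%N -> hvanish j i.+1 t.
Proof.
move=> reg; elim=> [|j IH] i t jn qt; first exact: hvanish0S.
apply: hvanish_cone; first by apply: IH => //; exact: ltnW.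
case: i => [|i]; first by apply/hinj0P; exact: reg.
by apply: hvanish_inj; apply: IH => //; exact: ltnW.
Qed.

(* Vanishing for all n elements makes y_j injective on the homology of the first
   j ones; as the latter vanishes in high degrees, it then vanishes downwards. *)
Lemma regular_of_hvanish n q q' :
  (forall j t, (j < n)%N -> (q <= t)%N -> regular_at j t) ->
  (forall i t, (q' <= t)%N -> hvanish n i.+1 t) ->
  forall j t, (j < n)%N -> (q' <= t)%N -> regular_at j t.
Proof.
move=> reg van.
have high := hvanish_of_regular reg.
suff low j : (j <= n)%N -> forall i t, (q' <= t)%N -> hvanish j i.+1 t.
  by move=> j t jn q't; apply/hinj0P; apply: hinj_cone; apply: low.
(* Descending induction on the number of elements, written as n - d. *)
move=> jn; rewrite -(subKn jn); move: (n - j)%N => d {j jn}.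
elim: d => [|d IH] i t q't; first by rewrite subn0; exact: van.
have [nd|dn] := leqP n d.
  suff -> : (n - d.+1 = 0)%N by exact: hvanish0S.
  by apply/eqP; rewrite subn_eq0 ltnW.
have inj s : (q' <= s)%N -> hinj (n - d.+1) i.+1 s.
  by move=> q's; apply: hinj_cone; rewrite subnSK //; exact: IH.
(* Degree t + q lies in the range where regularity is given; from there the vanishing comes down to
   t degree by degree. *)
have : hvanish (n - d.+1) i.+1 (t + q)%N by apply: high; rewrite ?leq_subr ?leq_addl.
elim: q {reg high} => [|q IHq]; first by rewrite addn0.
move=> h; apply: IHq; apply: hvanish_pred; last by rewrite -addnS.
by apply: inj; rewrite (leq_trans q't) ?leq_addr.
Qed.

End Homology.

(** * The long exact sequence of 0 -> N -> U -> U/N -> 0 *)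

Section Transfer.

Variables (V : lmodType R) (U N : nat -> V -> Prop).
Hypothesis Ug : forall t, subgroup (U t).
Hypothesis Ng : forall t, subgroup (N t).
Hypothesis NU : forall t v, N t v -> U t v.
Hypothesis Uy : forall t i v, U t v -> U t.+1 (y i *: v).

Local Notation zero := (@zero_sub V).

Lemma subgroup_zero t : subgroup (zero t).
Proof. by split=> // u v <- <-; rewrite /zero_sub subrr. Qed.

(** The inclusion induces the zero map H_i(N) -> H_i(U). This is weaker than the vanishing of
    H_i(U), which for i = 0 fails for a free module in the degrees of its basis. *)
Definition cycles_bound j i t := forall c : koszul V j,
  hdeg i c -> all_entries (N t) c -> kdiff c = 0 ->
  exists b, [/\ hdeg i.+1 b, all_entries (U t.-1) b & c = kdiff b].

Lemma cycles_bound_hvanish j i t : hvanish U zero j i t -> cycles_bound j i t.+1.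
Proof.
move=> van c hc Nc dc0; have [||b [hb Ub /all_entries_eq0 db]] := van c hc.
- by apply: all_entries_sub Nc; exact: NU.
- by rewrite dc0; apply: all_entries0; exact: subgroup_zero.
by exists b; split=> //; apply/eqP; rewrite -subr_eq0; apply/eqP.
Qed.

Lemma cycles_bound0 j t :
  (forall v, N t.+1 v -> exists2 w : nat -> V,
     forall i, (i < j)%N -> U t (w i) & v = \sum_(i < j) y i *: w i) ->
  cycles_bound j 0 t.+1.
Proof.
move=> gen c /hdeg0P [v ->] /all_entries_embed0 Nv _.
have [w Uw ->] := gen v (Nv (Ng _)).
exists (embed1 j w); split; first exact: embed1_hdeg.
  exact/all_entries_embed1.
by rewrite kdiff_embed1.
Qed.

(** A cycle of N bounds some b in U; b is a cycle modulo N, and subtracting a boundary moves it into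
    N. The connecting map lowers the homological degree by one and raises the entry degree by
    one. *)
Lemma hvanish_sub j i t :
  cycles_bound j i t.+2 -> hvanish U N j i.+1 t -> hvanish N zero j i t.+1.
Proof.
move=> cb vanUN c hc Nc /all_entries_eq0 dc0.
have [b [hb Ub db]] := cb c hc Nc dc0.
have [|b' [hb' Ub' Nb']] := vanUN b hb Ub; first by rewrite -db.
exists (b - kdiff b'); split=> //; first by apply: hdegB => //; exact: hdeg_kdiff.
rewrite kdiffB kdiffK subr0 db subrr; apply: all_entries0; exact: subgroup_zero.
Qed.

(** Exactness of H_(i+1)(U) -> H_(i+1)(U/N) -> H_i(N): the boundary of a cycle modulo N is a cycle
    of N. *)
Lemma hvanish_quotient j i t :
  hvanish N zero j i t.+1 -> hvanish U zero j i.+1 t -> hvanish U N j i.+1 t.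
Proof.
move=> vanN vanU c hc Uc Nc.
have [|b [hb Nb /all_entries_eq0 db]] := vanN (kdiff c) (hdeg_kdiff hc) Nc.
  by rewrite kdiffK; apply: all_entries0; exact: subgroup_zero.
have [|||b' [hb' Ub' /all_entries_eq0 db']] := vanU (c - b).
- exact: hdegB.
- by apply: all_entriesB => //; apply: all_entries_sub Nb; exact: NU.
- by rewrite kdiffB db; apply: all_entries0; exact: subgroup_zero.
exists b'; split=> //.
suff -> : c - kdiff b' = b by [].
by rewrite -[RHS]addr0 -db' addrA addrCA subrr addr0.
Qed.

End Transfer.

(** * Invariance under isomorphisms of quotients *)

Section Iso.

Variables (V W : lmodType R) (f : V -> W).
Hypothesis f_lin : forall a u v, f (a *: u + v) = a *: f u + f v.
Variables (U Z : nat -> V -> Prop) (U' Z' : nat -> W -> Prop).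
Hypothesis fU : forall t v, U t v -> U' t (f v).
Hypothesis fU_surj : forall t w, U' t w -> exists2 v, U t v & f v = w.
Hypothesis fZ : forall t v, U t v -> (Z t v <-> Z' t (f v)).
Hypothesis Ug : forall t, subgroup (U t).
Hypothesis Uy : forall t i v, U t v -> U t.+1 (y i *: v).

Fixpoint kmap j : koszul V j -> koszul W j :=
  if j is j'.+1 then fun c => (kmap c.1, kmap c.2) else f.

Lemma kmap_lin j a (b c : koszul V j) : kmap (a *: b + c) = a *: kmap b + kmap c.
Proof.
elim: j b c => [|j IH] /= b c; first exact: f_lin.
by rewrite !IH.
Qed.

Lemma kmap0 j : kmap (0 : koszul V j) = 0.
Proof. by have := kmap_lin (-1) (0 : koszul V j) 0; rewrite addr0 scaler0 scaleN1r addNr. Qed.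

Lemma kmapB j (b c : koszul V j) : kmap (b - c) = kmap b - kmap c.
Proof. by rewrite addrC -scaleN1r kmap_lin scaleN1r addrC. Qed.

Lemma kmap_kdiff j (c : koszul V j) : kmap (kdiff c) = kdiff (kmap c).
Proof.
elim: j c => [|j IH] /= c; first exact: (kmap0 0).
by rewrite [_ + y j *: _]addrC kmap_lin -!IH addrC -[- _]add0r kmapB kmap0 add0r.
Qed.

Lemma kmap_hdeg j i (c : koszul V j) : hdeg i c -> hdeg i (kmap c).
Proof.
elim: j i c => [|j IH] [|i] //= c; first by move=> ->; exact: (kmap0 0).
  by move=> [/IH h ->]; split=> //; exact: kmap0.
by move=> [/IH h /IH h'].
Qed.

Lemma kmap_entries (S : V -> Prop) (T : W -> Prop) j (c : koszul V j) :
  (forall v, S v -> T (f v)) -> all_entries S c -> all_entries T (kmap c).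
Proof.
by move=> ST; elim: j c => [|j IH] /= c; [exact: ST | move=> [/IH h /IH h']].
Qed.

Lemma kmap_entries_inv t j (c : koszul V j) :
  all_entries (U t) c -> all_entries (Z' t) (kmap c) -> all_entries (Z t) c.
Proof.
elim: j c => [|j IH] /= c; first by move=> Uc; move/fZ; exact.
by move=> [? ?] [? ?]; split; exact: IH.
Qed.

Let kdiffU t j (c : koszul V j) :
  all_entries (U t) c -> all_entries (U t.+1) (kdiff c).
Proof. by apply: all_entries_kdiff => // i v; exact: Uy. Qed.

Lemma kmap_surj t j i (c : koszul W j) : hdeg i c -> all_entries (U' t) c ->
  exists b, [/\ hdeg i b, all_entries (U t) b & kmap b = c].
Proof.
elim: j i c => [|j IH] i c.
  case: i => [|i] /=; first by move=> _ /fU_surj [b Ub <-]; exists b.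
  move=> -> _; exists 0; split=> //; [by case: (Ug t) | exact: (kmap0 0)].
case: c => a b /= [ha hb] [/(IH i _ ha) [a' [ha' Ua' <-]] Ub].
case: i ha hb ha' => [|i] ha hb ha'.
  exists (a', 0); split=> //=; last by rewrite hb kmap0.
  by split=> //; exact: all_entries0.
by have [b' [hb' Ub' <-]] := IH i _ hb Ub; exists (a', b').
Qed.

(** [f] induces an isomorphism from U/Z to U'/Z'. Since Z is the preimage of Z' only within U, a
    chain compared with Z must first be seen to have its entries in U. *)
Lemma hvanish_iso j i t : hvanish U Z j i t <-> hvanish U' Z' j i t.
Proof.
split=> van c hc Uc Zc.
  have [c' [hc' Uc' Ec]] := kmap_surj hc Uc.
  have [|b [hb Ub Zb]] := van c' hc' Uc'.
    apply: kmap_entries_inv; first exact: kdiffU Uc'.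
    by rewrite kmap_kdiff Ec.
  exists (kmap b); split; [exact: kmap_hdeg | by apply: kmap_entries Ub => v; exact: fU |].
  rewrite -kmap_kdiff -Ec -kmapB.
  apply: (@kmap_entries (fun v => U t.+1 v /\ Z t.+1 v)); first by move=> v [Uv /(fZ Uv)].
  apply: all_entries_I => //; apply: all_entriesB => //.
  exact: kdiffU Ub.
have [|||b' [hb' Ub' Zb']] := van (kmap c).
- exact: kmap_hdeg.
- by apply: kmap_entries Uc => v; exact: fU.
- rewrite -kmap_kdiff.
  apply: (@kmap_entries (fun v => U t.+2 v /\ Z t.+2 v)); first by move=> v [Uv /(fZ Uv)].
  by apply: all_entries_I => //; exact: kdiffU Uc.
have [b [hb Ub Eb]] := kmap_surj hb' Ub'.
exists b; split=> //; apply: kmap_entries_inv.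
  by apply: all_entriesB => //; exact: kdiffU Ub.
by rewrite kmapB kmap_kdiff Eb.
Qed.

End Iso.

End Koszul.

(** * The degree reverse lexicographic order *)

Section DegRevLex.

Variable n : nat.
Implicit Types (m : 'X_{1..n}) (j : nat).

Lemma drl_irr m : drl_lt m m = false.
Proof.
rewrite /drl_lt ltnn eqxx /=; apply/negbTE/existsP => -[i].
by rewrite ltnn.
Qed.

Lemma drl_ltP m1 m2 : mdeg m1 = mdeg m2 ->
  reflect (exists2 i : 'I_n, (m2 i < m1 i)%N
             & forall j : 'I_n, (j < i)%N -> m1 j = m2 j) (drl_lt m1 m2).
Proof.
move=> d12; rewrite /drl_lt d12 ltnn eqxx /=.
apply: (iffP existsP) => -[i]; last first.
  move=> lti eqi; exists i; rewrite lti /=.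
  by apply/forallP => j; apply/implyP => /eqi ->.
move=> /andP [lti /forallP eqi]; exists i => // j ji.
by have := eqi j; rewrite ji => /eqP.
Qed.

Lemma drl_lt_deg m1 m2 : drl_lt m1 m2 -> (mdeg m1 <= mdeg m2)%N.
Proof. by case/orP => [/ltnW //|/andP [/eqP ->]]. Qed.

Lemma drl_trans m2 m1 m3 : drl_lt m1 m2 -> drl_lt m2 m3 -> drl_lt m1 m3.
Proof.
move=> l12 l23; have d12 := drl_lt_deg l12; have d23 := drl_lt_deg l23.
have [d13|d31] := ltnP (mdeg m1) (mdeg m3); first by rewrite /drl_lt d13.
have e12 : mdeg m1 = mdeg m2.
  by apply/eqP; rewrite eqn_leq d12 (leq_trans d23 d31).
have e23 : mdeg m2 = mdeg m3.
  by apply/eqP; rewrite eqn_leq d23 -e12 d31.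
move: l12 l23 => /(drl_ltP e12) [a lta eqa] /(drl_ltP e23) [b ltb eqb].
apply/(drl_ltP (etrans e12 e23)).
have [ab|ba|/val_inj ab] := ltngtP a b.
- exists a => [|j ja]; first by rewrite -eqb.
  by rewrite eqa // eqb // (ltn_trans ja).
- exists b => [|j jb]; first by rewrite eqa.
  by rewrite eqa ?eqb // (ltn_trans jb).
- by subst b; exists a => [|j ja]; [exact: ltn_trans lta | rewrite eqa ?eqb].
Qed.

Lemma drl_total m1 m2 : m1 != m2 -> drl_lt m1 m2 || drl_lt m2 m1.
Proof.
move=> ne12; have [d12|d21|d12] := ltngtP (mdeg m1) (mdeg m2).
- by rewrite /drl_lt d12.
- by rewrite orbC /drl_lt d21.
have [i0 ne0] : exists i, m1 i != m2 i.
  apply/existsP; apply: contraR ne12 => /existsPn eq12.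
  by apply/eqP/mnmP => i; have := eq12 i; rewrite negbK => /eqP.
case: (arg_minnP (fun i : 'I_n => i : nat) (P := fun i : 'I_n => m1 i != m2 i) ne0) => i ne min.
have eqi (j : 'I_n) : (j < i)%N -> m1 j = m2 j.
  by apply: contraTeq => /min; rewrite -leqNgt.
have [lt|lt|eq] := ltngtP (m1 i) (m2 i); last by rewrite eq eqxx in ne.
  by apply/orP; right; apply/(drl_ltP (esym d12)); exists i => // j /eqi.
by apply/orP; left; apply/(drl_ltP d12); exists i.
Qed.

Lemma drl_asym m1 m2 : drl_lt m1 m2 -> drl_lt m2 m1 = false.
Proof.
move=> l12; apply: contraTF l12 => l21; apply/negP => /drl_trans /(_ l21).
by rewrite drl_irr.
Qed.

Lemma drl_ltD m m1 m2 : drl_lt m1 m2 -> drl_lt (m + m1)%MM (m + m2)%MM.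
Proof.
rewrite /drl_lt !mdegD ltn_add2l eqn_add2l => /orP [->//|/andP [-> /existsP [i]]].
move=> /andP [lti /forallP eqi]; apply/orP; right; apply/existsP; exists i.
rewrite !mnmDE ltn_add2l lti; apply/forallP => j; apply/implyP => ji.
by have := eqi j; rewrite ji !mnmDE eqn_add2l.
Qed.

Definition touches j m := [exists i : 'I_n, (i < j)%N && (m i != 0)%N].

(** The reverse lexicographic tie-break at work: m2 vanishes up to the least index that occurs in
    m1, so the first difference is positive on the side of m1. *)
Lemma touches_lt j m1 m2 :
  mdeg m1 = mdeg m2 -> touches j m1 -> ~~ touches j m2 -> drl_lt m1 m2.
Proof.
move=> d12 /existsP [i0 Pi0] /existsPn T2.
case: (arg_minnP (fun i : 'I_n => i : nat) (P := fun i : 'I_n => (i < j)%N && (m1 i != 0)%N) Pi0).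
move=> i /andP [ij ne] min; apply/(drl_ltP d12).
have m20 (a : 'I_n) : (a < j)%N -> m2 a = 0%N.
  by move=> aj; have := T2 a; rewrite aj negbK => /eqP.
exists i; first by rewrite m20 // lt0n.
move=> a ai; rewrite m20 ?(ltn_trans ai) //; apply/eqP.
by apply: contraTT ai => ne'; rewrite -leqNgt; have [aj|ja] := ltnP a j;
  [rewrite min // aj | rewrite ltnW // (leq_trans ij)].
Qed.

Lemma touchesD j m m' : touches j m -> touches j (m + m')%MM.
Proof.
case/existsP => i /andP [ij ne]; apply/existsP; exists i.
by rewrite ij mnmDE addn_eq0 negb_and ne.
Qed.

Lemma touchesU (j : 'I_n) m : touches j (m + U_(j))%MM = touches j m.
Proof.
apply/idP/idP => [/existsP [i /andP [ij ne]]|/touchesD -> //].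
apply/existsP; exists i; rewrite ij /=.
move: ne; rewrite mnmDE mnm1E; have [E|_] := eqVneq j i; last by rewrite addn0.
by rewrite E ltnn in ij.
Qed.

Lemma submU m (j : 'I_n) : m j != 0%N -> (m - U_(j) + U_(j))%MM = m.
Proof.
move=> mj; apply: submK; apply/mnm_lepP => i; rewrite mnm1E.
by case: eqVneq => // <-; rewrite lt0n.
Qed.

Lemma clsP m : m != 0%MM ->
  exists j : 'I_n, [/\ cls m = j.+1, m j != 0%N & ~~ touches j m].
Proof.
move=> m0; have hm : has (fun e : nat => e != 0%N) m.
  apply: contraR m0 => /hasPn hm; apply/eqP/mnmP => i; rewrite mnm0E.
  by have := hm _ (mem_tnth i m); rewrite negbK => /eqP.
have := hm; rewrite has_find size_tuple => fm.
exists (Ordinal fm); rewrite /cls (negbTE m0); split=> //.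
  by rewrite (mnm_nth 0%N) /=; exact: (nth_find 0%N hm).
apply/existsPn => i; rewrite negb_and -implybE; apply/implyP => /= /(before_find 0%N).
by rewrite (mnm_nth 0%N) => /negbT.
Qed.

End DegRevLex.

Section Lead.

Variables (k : fieldType) (n : nat).
Implicit Types (f : {mpoly k[n]}) (m : 'X_{1..n}).

(** Adding the default value 0, the smallest exponent, to the list makes the claim hold for the
    empty list too. *)
Let lead_max (s : seq 'X_{1..n}) :
  let l := foldr (fun m1 m2 => if drl_lt m2 m1 then m1 else m2) 0%MM s in
  (l \in 0%MM :: s) /\ forall m, m \in 0%MM :: s -> m = l \/ drl_lt m l.
Proof.
have zero m : m = 0%MM \/ drl_lt 0%MM m.
  have [->|m0] := eqVneq m 0%MM; first by left.
  by right; rewrite /drl_lt mdeg0 lt0n mdeg_eq0 m0.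
elim: s => [|a s [IH1 IH2]] /=.
  by split=> [|m]; rewrite ?inE // => /eqP ->; left.
move: IH1 IH2; set l := foldr _ _ _ => IH1 IH2.
case: ifP => [la|/negbT nla]; split.
- by rewrite !inE eqxx orbT.
- move=> m; rewrite !inE => /or3P [/eqP ->|/eqP ->|ms]; [by case: (zero a); auto|by left|].
  right; have [->//|ml] : m = l \/ drl_lt m l by apply: IH2; rewrite inE ms orbT.
  exact: drl_trans ml la.
- by move: IH1; rewrite !inE => /orP [->|->]; rewrite ?orbT.
- move=> m; rewrite !inE => /or3P [/eqP ->|/eqP ->|ms]; [by case: (zero l); auto| |].
    have [->|al] := eqVneq a l; first by left.
    by have := drl_total al; rewrite (negbTE nla) orbF; right.
  by apply: IH2; rewrite inE ms orbT.
Qed.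

Lemma drl_lead_in f : f != 0 -> drl_lead f \in msupp f.
Proof.
rewrite /drl_lead -msupp_eq0; case: (msupp f) => // a s _.
have [] := lead_max (a :: s); move: (foldr _ _ _) => l.
rewrite inE => /orP [/eqP ->|//] /(_ a); rewrite !inE eqxx orbT => -[//|<-|].
  by rewrite eqxx.
by move/drl_lt_deg; rewrite mdeg0 leqn0 mdeg_eq0 => /eqP ->; rewrite eqxx.
Qed.

Lemma drl_lead_max f m : m \in msupp f -> m != drl_lead f -> drl_lt m (drl_lead f).
Proof.
move=> mf ne; have [_ /(_ m)] := lead_max (msupp f).
by rewrite inE mf orbT => -[//|eq|//]; rewrite [m]eq eqxx in ne.
Qed.

Lemma drl_leadP f m : m \in msupp f ->
  (forall m', m' \in msupp f -> m' != m -> drl_lt m' m) -> drl_lead f = m.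
Proof.
move=> mf max; apply/eqP; apply: contraT => ne.
have f0 : f != 0 by apply: contraTneq mf => ->; rewrite msupp0.
have := max _ (drl_lead_in f0) ne; rewrite drl_asym //.
by apply: drl_lead_max; rewrite // eq_sym.
Qed.

Lemma mdeg_drl_lead f : f != 0 -> mdeg (drl_lead f) = (msize f).-1.
Proof.
move=> f0; have lf := drl_lead_in f0.
suff -> : msize f = (mdeg (drl_lead f)).+1 by [].
apply/eqP; rewrite eqn_leq msize_mdeg_lt // andbT.
rewrite msizeE; apply/bigmax_leqP_seq => m mf _; rewrite ltnS.
have [->//|/(drl_lead_max mf)] := eqVneq m (drl_lead f).
exact: drl_lt_deg.
Qed.

(* [shomog s] is homogeneity of degree s - 1. *)
Definition shomog (s : nat) f : bool := if s is e.+1 then f \is e.-homog else f == 0.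

Lemma shomog0 s : shomog s 0.
Proof. by case: s => [|s] /=; rewrite ?eqxx ?dhomog0. Qed.

Lemma shomogB s f g : shomog s f -> shomog s g -> shomog s (f - g).
Proof. by case: s => [/eqP -> /eqP ->|s] /=; [rewrite subrr | exact: rpredB]. Qed.

Lemma shomogM s d f g : g \is d.-homog -> shomog s f -> shomog (s + d) (g * f).
Proof.
move=> hg; case: s => [/eqP ->|s hf]; first by rewrite mulr0; exact: shomog0.
by rewrite addSn addnC; exact: dhomogM.
Qed.

Lemma homogXM (j : 'I_n) t f : shomog t f -> 'X_j * f \is t.-homog.
Proof.
case: t => [/eqP ->|t hf]; first by rewrite mulr0 dhomog0.
by rewrite -add1n; apply: dhomogM => //; rewrite dhomogX; apply/eqP; exact: mdeg1.
Qed.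

Lemma mcoeff_sum_msupp (Q : pred 'X_{1..n}) f m :
  (\sum_(m' <- msupp f | Q m') f@_m' *: 'X_[m'])@_m = if Q m then f@_m else 0.
Proof.
rewrite raddf_sum /=.
under eq_bigr do rewrite mcoeffZ mcoeffX.
have [mf|mf] := boolP (m \in msupp f); last first.
  rewrite big_seq_cond big1 => [|m' /andP [mf' _]].
    by case: ifP => // _; apply/eqP; rewrite eq_sym mcoeff_eq0.
  have [E|_] := eqVneq m' m; last by rewrite mulr0.
  by rewrite -E mf' in mf.
case: ifP => [dm|dm].
  rewrite big_mkcond (bigD1_seq m) ?msupp_uniq //= dm eqxx mulr1 big1 ?addr0 //.
  by move=> m' /negbTE ->; rewrite mulr0; case: ifP.
rewrite big1 // => m' dm'; have [E|_] := eqVneq m' m; last by rewrite mulr0.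
by rewrite -E dm' in dm.
Qed.

Lemma mcoeff_pihomog d f m : (pihomog mdeg d f)@_m = if mdeg m == d then f@_m else 0.
Proof. by rewrite pihomogE mcoeff_sum_msupp. Qed.

Lemma drl_lead_pihomog f : f != 0 ->
  let g := pihomog mdeg (mdeg (drl_lead f)) f in g != 0 /\ drl_lead g = drl_lead f.
Proof.
move=> f0 /=; have lf := drl_lead_in f0.
have lg : drl_lead f \in msupp (pihomog mdeg (mdeg (drl_lead f)) f).
  by rewrite mcoeff_msupp mcoeff_pihomog eqxx -mcoeff_msupp.
split; first by apply: contraTneq lg => ->; rewrite msupp0.
apply: drl_leadP => // m; rewrite mcoeff_msupp mcoeff_pihomog.
case: ifP; last by rewrite eqxx.
by move=> _; rewrite -mcoeff_msupp; exact: drl_lead_max.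
Qed.

(** Indexed by [nat], like the sequence of a Koszul complex, with value 0 beyond the last
    variable. *)
Definition var (i : nat) : {mpoly k[n]} := if insub i is Some o then 'X_o else 0.

Lemma var_ord (i : 'I_n) : var i = 'X_i.
Proof. by rewrite /var valK. Qed.

(** [u] is the quotient of the part of f divisible by the variable; the remainder is made of the
    other monomials. *)
Lemma divX (j : 'I_n) t f : f \is t.-homog -> exists2 u, shomog t u
  & forall m, (f - 'X_j * u)@_m = if m j == 0%N then f@_m else 0.
Proof.
move=> hf; exists (\sum_(m <- msupp f | m j != 0%N) f@_m *: 'X_[m - U_(j)]).
  case: t hf => [|t] hf /=.
    rewrite big_seq_cond big1 // => m /andP [mf].
    have /eqP := dhomog_mf hf mf; rewrite mdeg_eq0 => /eqP ->.
    by rewrite mnm0E eqxx.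
  rewrite big_seq_cond; apply: rpred_sum => m /andP [mf mj].
  apply: dhomogZ; rewrite dhomogX; apply/eqP/succn_inj.
  have <- : mdeg m = t.+1 := dhomog_mf hf mf.
  by rewrite -[in RHS](submU mj) mdegD mdeg1 addn1.
move=> m; rewrite -(mcoeff_sum_msupp (fun m : 'X_{1..n} => m j == 0%N)).
congr (_ @_ m); rewrite {1}[f]mpolyE (bigID (fun m : 'X_{1..n} => m j == 0%N)) /=.
rewrite mulr_sumr [X in _ + X - _](_ : _ = \sum_(m' <- msupp f | m' j != 0%N)
  'X_j * (f@_m' *: 'X_[m' - U_(j)])) ?addrK //.
by apply: eq_bigr => m' mj; rewrite -scalerAr -mpolyXD addmC submU.
Qed.

(** Membership in the ideal of the first j variables, which for a monomial ideal can be read off the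
    coefficients. *)
Definition in_vars j f := forall m, ~~ touches j m -> f@_m = 0.

Lemma in_varsB j f g : in_vars j f -> in_vars j g -> in_vars j (f - g).
Proof. by move=> Tf Tg m Tm; rewrite mcoeffB Tf // Tg // subrr. Qed.

Lemma in_varsD j f g : in_vars j f -> in_vars j g -> in_vars j (f + g).
Proof. by move=> Tf Tg m Tm; rewrite mcoeffD Tf // Tg // addr0. Qed.

Lemma in_varsM j f g : in_vars j f -> in_vars j (f * g).
Proof.
move=> Tf m Tm; apply/eqP; rewrite mcoeff_eq0; apply/negP => /msuppM_le.
case/allpairsP => -[m1 m2] /= [m1f _ eqm].
move: m1f; rewrite mcoeff_msupp Tf ?eqxx //.
by apply: contra Tm => T1; rewrite eqm touchesD.
Qed.

Lemma in_vars_var j i : (i < j)%N -> in_vars j (var i).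
Proof.
rewrite /var => ij m Tm; case: insubP => [o _ oi|_]; last by rewrite mcoeff0.
rewrite mcoeffX; case: eqVneq => // eqm; case/negP: Tm.
by apply/existsP; exists o; rewrite oi ij -eqm mnm1E eqxx.
Qed.

Lemma in_vars_sum j (u : nat -> {mpoly k[n]}) :
  in_vars j (\sum_(i < j) var i * u i).
Proof.
apply: big_ind => [m _||i _]; [by rewrite mcoeff0 | exact: in_varsD |].
by apply: in_varsM; apply: in_vars_var.
Qed.

Lemma in_vars_split j t f : f \is t.-homog -> in_vars j f ->
  exists2 u : nat -> {mpoly k[n]}, forall i, shomog t (u i) & f = \sum_(i < j) var i * u i.
Proof.
elim: j f => [|j IH] f hf Tf.
  exists (fun=> 0) => [i|]; first exact: shomog0.
  rewrite big_ord0; apply/mpolyP => m; rewrite mcoeff0 Tf //.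
  by apply/existsPn => i.
have [jn|nj] := ltnP j n; last first.
  have [m|u hu ->] := IH f hf.
    move=> Tm; apply: Tf; apply: contra Tm => /existsP [i /andP [_ ne]].
    by apply/existsP; exists i; rewrite ne andbT (leq_trans (ltn_ord i)).
  exists (fun i => if i == j then 0 else u i) => [i|].
    by case: eqP => _; rewrite ?shomog0 ?hu.
  rewrite big_ord_recr /= eqxx mulr0 addr0; apply: eq_bigr => i _.
  by rewrite ltn_eqF.
have [v hv fv] := divX (Ordinal jn) hf.
have [|m Tm|u hu Eu] := IH (f - 'X_(Ordinal jn) * v).
- by apply: rpredB => //; exact: homogXM.
- rewrite fv; case: eqP => // mj; apply: Tf; apply: contra Tm.
  move=> /existsP [i]; rewrite ltnS leq_eqVlt => /andP [/orP [/eqP ij|ij] ne].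
    by case/negP: ne; rewrite -mj; apply/eqP; congr (m _); apply: val_inj.
  by apply/existsP; exists i; rewrite ij.
exists (fun i => if i == j then v else u i) => [i|]; first by case: eqP.
rewrite big_ord_recr /= eqxx -[f](subrK ('X_(Ordinal jn) * v)) Eu.
congr (_ + _); last by rewrite -(var_ord (Ordinal jn)).
by apply: eq_bigr => i _; rewrite ltn_eqF.
Qed.

End Lead.

(** * Pommaret bases and quotients by variables *)

Section Ideals.

Variables (k : fieldType) (n : nat) (J : {mpoly k[n]} -> Prop).
Hypothesis J_homog : homogeneous_ideal J.

Lemma idealZ c f : J f -> J (c *: f).
Proof. by rewrite -mul_mpolyC; exact: hidealM. Qed.

Lemma idealN f : J f -> J (- f).
Proof. by rewrite -scaleN1r; exact: idealZ. Qed.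

Lemma idealB f g : J f -> J g -> J (f - g).
Proof. by move=> Jf Jg; apply: (hidealD J_homog) => //; exact: idealN. Qed.

Lemma pihomog_in_vars j d (f : {mpoly k[n]}) :
  in_vars j f -> in_vars j (pihomog mdeg d f).
Proof. by move=> Tf m Tm; rewrite mcoeff_pihomog Tf // if_same. Qed.

Definition leads m := exists f, [/\ J f, f != 0 & drl_lead f = m].

(* Modulo x_1, ..., x_j the leading exponent survives, as the monomials
   involving these variables are the smallest ones of their degree. *)
Lemma leads_in_vars j t (v g : {mpoly k[n]}) m :
  v \is t.-homog -> J g -> in_vars j (v - g) ->
  m \in msupp v -> ~~ touches j m ->
  (forall m', m' \in msupp v -> m' != m -> drl_lt m' m) -> leads m.
Proof.
move=> hv Jg Tvg mv Tm max.
have dm : mdeg m = t := dhomog_mf hv mv.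
pose g' := pihomog mdeg t g.
have Tg' : in_vars j (v - g').
  by rewrite /g' -[v in v - _](pihomog_dE hv) -pihomogB; exact: pihomog_in_vars.
have mg' : m \in msupp g'.
  have := Tg' _ Tm; rewrite mcoeffB => /eqP; rewrite subr_eq0 !mcoeff_msupp => /eqP <-.
  by rewrite -mcoeff_msupp.
exists g'; split; first exact: (hideal_component J_homog).
  by apply: contraTneq mg' => ->; rewrite msupp0.
apply: drl_leadP => // m' m'g ne.
have [m'v|m'v] := boolP (m' \in msupp v); first exact: max.
apply: (@touches_lt _ j) => //.
  by rewrite dm; exact: (dhomog_mf (pihomogP _ _ _) m'g).
apply: contraTT m'g => /Tg'; rewrite mcoeffB => /eqP; rewrite subr_eq0 => /eqP E.
by rewrite mcoeff_msupp -E -mcoeff_msupp.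
Qed.

(** In degree t, the colon ideal of (J, x_1, ..., x_j) by x_(j+1) is no larger than (J, x_1, ...,
    x_j). The explicit cofactors give it the shape of [regular_at]; [colon_atP] trades them for
    [in_vars], which suits leading exponents. *)
Definition colon_at j t := forall (v : {mpoly k[n]}) (u : nat -> {mpoly k[n]}),
  v \is t.-homog -> (forall i, (i < j)%N -> u i \is t.-homog) ->
  J (var k n j * v - \sum_(i < j) var k n i * u i) ->
  exists2 w : nat -> {mpoly k[n]}, forall i, (i < j)%N -> shomog t (w i)
    & J (v - \sum_(i < j) var k n i * w i).

Lemma colon_atP j t :
  (forall v, v \is t.-homog ->
     (exists2 g, J g & in_vars j (var k n j * v - g)) ->
     exists2 g, J g & in_vars j (v - g)) <-> colon_at j t.
Proof.
split=> [col v u hv hu Ju|col v hv [g Jg Tg]].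
  have [|g Jg Tg] := col v hv.
    exists (var k n j * v - \sum_(i < j) var k n i * u i) => //.
    by rewrite subKr; exact: in_vars_sum.
  have := pihomog_in_vars t Tg; have := pihomogP mdeg t (v - g).
  rewrite pihomogB (pihomog_dE hv) => hg /(in_vars_split hg) [w hw E].
  by exists w => [i _ //|]; rewrite -E subKr; exact: (hideal_component J_homog).
(* For j >= n the variable is 0, and the hypothesis of [colon_at] holds with zero cofactors. *)
case: (boolP (j < n)%N) => [jn|nj]; last first.
  have vj : var k n j = 0 by rewrite /var insubN.
  have [|w _ Jw] := col v (fun=> 0) hv (fun _ _ => dhomog0 _ _ _).
    by rewrite vj mul0r big1 ?subrr => [|i _]; rewrite ?mulr0 //; exact: (hideal0 J_homog).
  by exists (v - \sum_(i < j) var k n i * w i) => //; rewrite subKr; exact: in_vars_sum.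
have hXv : var k n j * v \is t.+1.-homog.
  by rewrite (var_ord k (Ordinal jn)); exact: homogXM.
have := pihomog_in_vars t.+1 Tg; have := pihomogP mdeg t.+1 (var k n j * v - g).
rewrite pihomogB (pihomog_dE hXv) => hg /(in_vars_split hg) [u hu E].
have [i _||w _ Jw] := col v u hv; first exact: hu.
  by rewrite -E subKr; exact: (hideal_component J_homog).
by exists (v - \sum_(i < j) var k n i * w i) => //; rewrite subKr; exact: in_vars_sum.
Qed.

Lemma cone_refl m : pommaret_cone (n:=n) m m.
Proof. by exists 0%MM => [|i _]; rewrite ?addm0 // mnm0E. Qed.

Variable H : seq {mpoly k[n]}.
Hypothesis JH : pommaret_basis J H.

(** Let m + U_(j) = [drl_lead h] + rho lie in the cone of h. If rho involves j, one step back stays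
    in the cone and reaches m. Otherwise [drl_lead h] involves j and nothing smaller, so its class
    is j + 1, rho can only live on indices up to j, and hence is 0. *)
Lemma leads_border (j : 'I_n) m : ~~ touches j m ->
  leads (m + U_(j))%MM -> leads m \/ exists2 h, h \in H & drl_lead h = (m + U_(j))%MM.
Proof.
move=> Tm /(pommaret_cover JH) [h hH [rho E mult]].
have [rj|rj] := eqVneq (rho j) 0%N; last first.
  left; apply/(pommaret_cover JH); exists h => //; exists (rho - U_(j))%MM.
    apply/eqP; rewrite -(eqm_add2r U_(j)); apply/eqP.
    by rewrite E -addmA submU.
  by move=> i /mult ri; rewrite mnmBE ri.
right; exists h => //.
have zero (i : 'I_n) : (i < j)%N -> (drl_lead h i + rho i = 0)%N.
  move=> ij; rewrite -mnmDE -E mnmDE mnm1E -val_eqE gtn_eqF // addn0; apply/eqP.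
  apply: contraNT Tm => ne; apply/existsP; exists i; by rewrite ij ne.
have hj : drl_lead h j != 0%N.
  by have /mnmP /(_ j) := E; rewrite !mnmDE mnm1E eqxx rj addn0 addn1 => <-.
have h0 : drl_lead h != 0%MM by apply: contraNneq hj => ->; rewrite mnm0E.
have [c [cE hc Tc]] := clsP h0.
have cj : c = j.
  apply/val_inj/eqP; rewrite eqn_leq; apply/andP; split; rewrite leqNgt.
    apply: contra Tc => jc; apply/existsP; exists j; by rewrite jc.
  by apply: contra hc => /zero /eqP; rewrite addn_eq0 => /andP [].
rewrite E [rho](_ : _ = 0%MM) ?addm0 //; apply/mnmP => i; rewrite mnm0E.
have [ij|ji|/val_inj -> //] := ltngtP i j.
  by apply/eqP; have /eqP := zero _ ij; rewrite addn_eq0 => /andP [].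
by apply: mult; rewrite cE cj ltnS.
Qed.

(** The number of exponents of degree at most t below m: a finite measure that decreases when a form
    of degree t is reduced. *)
Let rank t m := #|[pred m' : 'X_{1..n < t.+1} | drl_lt (val m') m]|.

Let rank_lt t m1 m2 : (mdeg m1 <= t)%N -> drl_lt m1 m2 -> (rank t m1 < rank t m2)%N.
Proof.
rewrite -ltnS => d1 l12; apply: proper_card; apply/properP; split.
  by apply/subsetP => m; rewrite !inE => /drl_trans; exact.
by exists (BMultinom d1); rewrite !inE /= ?drl_irr.
Qed.

Lemma drl_reduce t (v f : {mpoly k[n]}) : v \is t.-homog -> f \is t.-homog ->
  v != 0 -> f != 0 -> drl_lead f = drl_lead v ->
  let v' := v - (v@_(drl_lead v) / f@_(drl_lead v)) *: f in
  v' = 0 \/ (rank t (drl_lead v') < rank t (drl_lead v))%N.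
Proof.
move=> hv hf v0 f0 lfv v'.
have [->|v'0] := eqVneq v' 0; [by left | right].
have hv' : v' \is t.-homog by apply: rpredB => //; exact: dhomogZ.
have l' := drl_lead_in v'0.
have dl : mdeg (drl_lead v') = t := dhomog_mf hv' l'.
apply: rank_lt; first by rewrite dl.
have ne : drl_lead v' != drl_lead v.
  apply: contraTneq l' => ->; rewrite mcoeff_msupp negbK mcoeffB mcoeffZ divfK ?subrr //.
  by rewrite -lfv -mcoeff_msupp; exact: drl_lead_in.
have := msuppB_le l'; rewrite mem_cat => /orP [lv|/msuppZ_le lf]; first exact: drl_lead_max.
by rewrite -lfv in ne *; exact: drl_lead_max.
Qed.

(** The leading term of v is cancelled repeatedly: by a monomial if it involves the first j
    variables, otherwise by an element of J. The latter exists because m + U_(j) is a leading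
    exponent of degree t + 1 > q, too large to come from H itself, so that [leads_border] leaves
    only m. *)
Lemma colon_of_pommaret q :
  (forall h, h \in H -> (mdeg (drl_lead h) <= q)%N) ->
  forall j t, (j < n)%N -> (q <= t)%N -> colon_at j t.
Proof.
move=> Hq j t jn qt; apply/colon_atP => v.
rewrite (var_ord k (Ordinal jn)); set x := 'X__; move=> hv.
have [N] : exists N, v = 0 \/ (rank t (drl_lead v) < N)%N.
  by exists (rank t (drl_lead v)).+1; right.
elim: N v hv => [|N IH] v hv; first case=> [-> _|//].
  by exists 0; rewrite ?subrr //; [exact: (hideal0 J_homog) | move=> m _; exact: mcoeff0].
have [-> _ _|v0] := eqVneq v 0.
  by exists 0; rewrite ?subrr //; [exact: (hideal0 J_homog) | move=> m _; exact: mcoeff0].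
case=> [/eqP|]; first by rewrite (negbTE v0).
rewrite ltnS => rN [g Jg Tg].
have lv := drl_lead_in v0; set m := drl_lead v in lv rN.
have dm : mdeg m = t := dhomog_mf hv lv.
(* Subtracting a multiple of f preserves the hypothesis on v and lowers the rank, whichever of the
   two ideals contains f. *)
have step f : f \is t.-homog -> f != 0 -> drl_lead f = m ->
    (J f \/ in_vars j f) -> exists2 g, J g & in_vars j (v - g).
  move=> hf f0 lf Jf; have := drl_reduce hv hf v0 f0 lf.
  rewrite -/m; set c := _ / _; set v' := v - c *: f => red.
  have hv' : v' \is t.-homog by apply: rpredB => //; exact: dhomogZ.
  have Ev : v = v' + c *: f by rewrite subrK.
  have [||g' Jg' Tg'] := IH v' hv'.
  - by case: red => [|red]; [left | right; exact: leq_trans red rN].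
  - case: Jf => Jf.
      exists (g - x * (c *: f)); first by apply: idealB => //; apply: hidealM => //; exact: idealZ.
      by rewrite mulrBr opprB addrA subrK.
    exists g => //; rewrite mulrBr addrAC; apply: in_varsB => //.
    by rewrite mulrC -scalerAl -mul_mpolyC mulrC; do 2![apply: in_varsM].
  case: Jf => Jf.
    exists (g' + c *: f); first by apply: (hidealD J_homog) => //; exact: idealZ.
    by rewrite Ev opprD addrA addrAC addrK.
  exists g' => //; rewrite Ev addrAC; apply: in_varsD => //.
  by rewrite -mul_mpolyC mulrC; exact: in_varsM.
have [Tm|Tm] := boolP (touches j m).
  have lX : drl_lead ('X_[m] : {mpoly k[n]}) = m.
    by apply: drl_leadP; rewrite msuppX ?inE // => m'; rewrite inE => ->.
  apply: (step 'X_[m]) => //.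
  - by rewrite dhomogX; apply/eqP.
  - by rewrite -msupp_eq0 msuppX.
  right=> m' Tm'; rewrite mcoeffX; case: eqVneq => // E.
  by rewrite -E Tm in Tm'.
have : leads (m + U_(Ordinal jn))%MM.
  apply: (@leads_in_vars j t.+1 (x * v) g) => //.
  - exact: homogXM.
  - by rewrite mulrC mcoeff_msupp addmC mcoeffMX -mcoeff_msupp.
  - by rewrite (touchesU (Ordinal jn)).
  move=> m' ; rewrite mulrC (perm_mem (msuppMX _ _)) => /mapP [m2 m2v ->] ne.
  rewrite [(m + _)%MM]addmC; apply: drl_ltD; apply: drl_lead_max => //.
  by apply: contraNneq ne => ->; rewrite addmC.
case/(@leads_border (Ordinal jn) m Tm) => [[f [Jf f0 lf]]|[h hH lh]].
  have [f'0 lf'] := drl_lead_pihomog f0; rewrite lf dm in f'0 lf'.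
  apply: (step (pihomog mdeg t f)) => //; first exact: pihomogP.
  by left; exact: (hideal_component J_homog).
by have := Hq h hH; rewrite lh mdegD mdeg1 addn1 dm ltnNge qt.
Qed.

(** An element h of degree above q makes mu - U_(j) a leading exponent. The cone that contains it
    extends in direction j and so contains mu as well; by disjointness its vertex is mu, whose
    degree is too large. *)
Lemma pommaret_of_colon q :
  (forall j t, (j < n)%N -> (q <= t)%N -> colon_at j t) ->
  forall h, h \in H -> (mdeg (drl_lead h) <= q)%N.
Proof.
move=> col h hH; rewrite leqNgt; apply/negP => qd.
have [Jh h0] := pommaret_sub JH hH.
set mu := drl_lead h in qd.
have mu0 : mu != 0%MM by rewrite -mdeg_eq0 -lt0n (leq_ltn_trans _ qd).
have [j [jE muj Tmu]] := clsP mu0.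
have [f0 lf] := drl_lead_pihomog h0; rewrite -/mu in f0 lf.
set f := pihomog _ _ _ in f0 lf.
have hf : f \is (mdeg mu).-homog by exact: pihomogP.
have Jf : J f by exact: (hideal_component J_homog).
have [t dmu] : exists t, mdeg mu = t.+1.
  by exists (mdeg mu).-1; rewrite prednK // (leq_ltn_trans _ qd).
rewrite dmu in hf qd; have [v hv fv] := divX j hf; rewrite /= in hv.
have muf : mu \in msupp f by rewrite -lf drl_lead_in.
have vE m : v@_m = f@_(m + U_(j))%MM.
  have := fv (m + U_(j))%MM; rewrite mnmDE mnm1E eqxx addn1 /=.
  by rewrite mcoeffB mulrC [in X in _ - X]addmC mcoeffMX => /eqP; rewrite subr_eq0 => /eqP.
(* A monomial of f without the variable j is smaller than mu, and the first difference can then only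
   occur at an index below j. *)
have Tfv : in_vars j (var k n j * v - f).
  move=> m Tm; rewrite var_ord -opprB mcoeffN fv; case: eqP => [mj|_]; last by rewrite oppr0.
  have [->|ne] := eqVneq (f@_m) 0; first by rewrite oppr0.
  rewrite -mcoeff_msupp in ne.
  have dm : mdeg m = mdeg mu by rewrite dmu; exact: (dhomog_mf hf ne).
  have nm : m != drl_lead f by rewrite lf; apply: contraNneq muj => <-; rewrite mj.
  have := drl_lead_max ne nm; rewrite lf => /(drl_ltP dm) [i lt eqi].
  have [ij|ji|/val_inj ij] := ltngtP i j.
  - case/negP: Tm; apply/existsP; exists i; rewrite ij -lt0n; exact: leq_ltn_trans lt.
  - by move: muj; rewrite -(eqi j ji) mj.
  - by rewrite ij mj in lt.
have [g Jg Tg] : exists2 g, J g & in_vars j (v - g).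
  apply: ((iffRL (colon_atP _ _)) (col j t _ qd)) => //; by exists f.
have Emu : ((mu - U_(j)) + U_(j))%MM = mu by rewrite submU.
have Tm : ~~ touches j (mu - U_(j))%MM by rewrite -(touchesU j) Emu.
have : leads (mu - U_(j))%MM.
  apply: (leads_in_vars hv Jg Tg) => //; first by rewrite mcoeff_msupp vE Emu -mcoeff_msupp.
  move=> m; rewrite mcoeff_msupp vE -mcoeff_msupp => mf ne.
  have nm : (m + U_(j))%MM != drl_lead f.
    by rewrite lf -Emu eqm_add2r.
  have := drl_lead_max mf nm; rewrite lf -{1}Emu.
  rewrite /drl_lt !mdegD ltn_add2r eqn_add2r => /orP [->//|/andP [-> /existsP [i]]].
  move=> /andP [lti /forallP eqi]; apply/orP; right; apply/existsP; exists i.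
  move: lti; rewrite !mnmDE ltn_add2r => ->; apply/forallP => a; apply/implyP => ai.
  by have := eqi a; rewrite ai !mnmDE eqn_add2r.
case/(pommaret_cover JH) => h' h'H [rho E mult].
(* The exponent of [h'] divides mu - U_(j), which involves no index below j. Its class is thus at
   least j + 1 (it is n for the exponent 0), and direction j is multiplicative. *)
have : pommaret_cone (drl_lead h') mu.
  exists (rho + U_(j))%MM; first by rewrite addmA -E Emu.
  move=> i ci; rewrite mnmDE mult // mnm1E; case: eqVneq => // ji.
  move: ci; rewrite -ji; have [z|z] := eqVneq (drl_lead h') 0%MM.
    by rewrite /cls z eqxx ltnS leqNgt ltn_ord.
  have [c [-> hc _]] := clsP z; rewrite ltnS => cj; case/negP: Tm.
  apply/existsP; exists c; rewrite cj E mnmDE addn_eq0 negb_and hc //.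
have [Eh _|ne] := eqVneq h' h; last first.
  by move=> ch'; case: (pommaret_disjoint JH h'H hH ne (conj ch' (cone_refl mu))).
have := congr1 (@mdeg n) Emu; rewrite E Eh -/mu !mdegD mdeg1 => /eqP.
by rewrite -addnA -{2}[mdeg mu]addn0 eqn_add2l addn1.
Qed.

End Ideals.

(** * Changes of coordinates *)

Section Coordinates.

Variables (k : fieldType) (n : nat).
Local Notation P := {mpoly k[n]}.

Definition subst_tuple (A : 'M[k]_n) : n.-tuple P :=
  [tuple \sum_(j < n) A i j *: 'X_j | i < n].

Definition subst (A : 'M[k]_n) (p : P) : P := p \mPo subst_tuple A.

Lemma subst0 A : subst A 0 = 0. Proof. exact: raddf0. Qed.
Lemma substB A : {morph subst A : p q / p - q}. Proof. exact: raddfB. Qed.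
Lemma substM A : {morph subst A : p q / p * q}. Proof. by move=> p q; rewrite /subst rmorphM. Qed.
Lemma subst_sum A (I : Type) (s : seq I) (Q : pred I) (F : I -> P) :
  subst A (\sum_(i <- s | Q i) F i) = \sum_(i <- s | Q i) subst A (F i).
Proof. exact: raddf_sum. Qed.

Lemma subst_tuple_homog A i : tnth (subst_tuple A) i \is 1.-homog.
Proof.
rewrite tnth_mktuple; apply: rpred_sum => j _; apply: dhomogZ.
by rewrite dhomogX; apply/eqP; exact: mdeg1.
Qed.

Lemma subst_homog A d p : p \is d.-homog -> subst A p \is d.-homog.
Proof.
move=> shomog; rewrite /subst comp_mpolyE big_seq; apply: rpred_sum => m mp.
apply: dhomogZ.
have <- : mdeg m = d := dhomog_mf shomog mp.
rewrite mdegE; apply: (big_ind2 (fun (f : P) e => f \is e.-homog)).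
- exact: dhomog1.
- by move=> f d1 g d2 hf hg; exact: dhomogM.
move=> i _; rewrite -[X in X.-homog]mul1n; apply: dhomogMn.
exact: subst_tuple_homog.
Qed.

Lemma subst_subst A B p : subst B (subst A p) = subst (A *m B) p.
Proof.
rewrite /subst (comp_mpolyE p (subst_tuple A)) raddf_sum comp_mpolyE; apply: eq_bigr => m _.
rewrite /= comp_mpolyZ rmorph_prod; congr (_ *: _); apply: eq_bigr => i _.
rewrite rmorphXn /= !tnth_mktuple; congr (_ ^+ _).
rewrite raddf_sum /=.
under eq_bigr => j _ do rewrite comp_mpolyZ comp_mpolyXU -tnth_nth tnth_mktuple scaler_sumr.
rewrite exchange_big; apply: eq_bigr => j _; rewrite mxE scaler_suml.
by apply: eq_bigr => l _; rewrite scalerA.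
Qed.

Lemma subst1 p : subst 1%:M p = p.
Proof.
rewrite -[RHS]comp_mpoly_id; congr (_ \mPo _); apply: eq_from_tnth => i.
rewrite !tnth_mktuple (bigD1 i) //= mxE eqxx scale1r big1 ?addr0 // => j /negbTE ji.
by rewrite mxE eq_sym ji scale0r.
Qed.

Lemma pihomog_subst A d p : pihomog mdeg d (subst A p) = subst A (pihomog mdeg d p).
Proof.
rewrite {1}(pihomog_partitionE (mf := mdeg) (leqnn (msize p))) subst_sum raddf_sum /=.
have homS e : subst A (pihomog mdeg e p) \is e.-homog.
  by apply: subst_homog; exact: pihomogP.
have [dp|pd] := ltnP d (msize p).
  rewrite (bigD1 (Ordinal dp)) //= (pihomog_dE (homS d)) big1 ?addr0 // => e ne.
  by apply: pihomog_ne0 (homS e).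
rewrite big1 => [|e _].
  suff -> : pihomog mdeg d p = 0 by rewrite subst0.
  apply/mpolyP => m; rewrite mcoeff_pihomog mcoeff0; case: eqP => // dm.
  by apply/eqP; rewrite mcoeff_eq0 msize_mdeg_ge // dm.
by apply: pihomog_ne0 (homS e); rewrite ltn_eqF // (leq_trans (ltn_ord e)).
Qed.

Lemma in_coordsE A (I : P -> Prop) g : in_coords A I g = I (subst A g).
Proof. by []. Qed.

Lemma in_coords_homog A (I : P -> Prop) : homogeneous_ideal I -> homogeneous_ideal (in_coords A I).
Proof.
move=> hI; split=> [|f g|f g|d f]; rewrite !in_coordsE.
- by rewrite subst0; exact: (hideal0 hI).
- by move=> If Ig; rewrite /subst comp_mpolyD; exact: (hidealD hI).
- by move=> Ig; rewrite substM; exact: (hidealM hI).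
by move=> If; rewrite -pihomog_subst; exact: (hideal_component hI).
Qed.

Variable A : 'M[k]_n.
Hypothesis A_unit : A \in unitmx.

Definition yvar (i : nat) : P := subst A (var k n i).

Lemma substK : cancel (subst A) (subst (invmx A)).
Proof. by move=> p; rewrite subst_subst mulmxV // subst1. Qed.

Lemma substVK : cancel (subst (invmx A)) (subst A).
Proof. by move=> p; rewrite subst_subst mulVmx // subst1. Qed.

Lemma subst_shomog B s p : shomog s p -> shomog s (subst B p).
Proof. by case: s => [/eqP ->|s] /=; [rewrite subst0 | exact: subst_homog]. Qed.

Lemma yvar_homog i : yvar i \is 1.-homog.
Proof.
apply: subst_homog; rewrite /var; case: insubP => [o _ _|_]; last exact: dhomog0.
by rewrite dhomogX; apply/eqP; exact: mdeg1.
Qed.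

Lemma yvar_shomog s i p : shomog s p -> shomog s.+1 (yvar i * p).
Proof. by rewrite -addn1; apply: shomogM; exact: yvar_homog. Qed.

Lemma yvar_gen t p : p \is t.+1.-homog ->
  exists2 u : nat -> P, forall i, shomog t.+1 (u i) & p = \sum_(i < n) yvar i * u i.
Proof.
move=> hp_p; have hp' : subst (invmx A) p \is t.+1.-homog by exact: subst_homog.
have [m Tm|u hu E] := in_vars_split (j := n) hp'.
  apply: contraNeq Tm => m0; rewrite -mcoeff_msupp in m0.
  have dm : mdeg m = t.+1 := dhomog_mf hp' m0.
  have : m != 0%MM by rewrite -mdeg_eq0 dm.
  by case/clsP => j [_ mj _]; apply/existsP; exists j; rewrite ltn_ord.
exists (fun i => subst A (u i)) => [i|]; first exact: subst_shomog.
rewrite -[LHS]substVK E subst_sum; apply: eq_bigr => i _.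
by rewrite substM.
Qed.

(** [colon_at] for all j and all degrees from q on, carried back from [in_coords A I] to I. *)
Definition ycolon (I : P -> Prop) q := forall j t, (j < n)%N -> (q <= t)%N ->
  forall (v : P) (u : nat -> P),
  v \is t.-homog -> (forall i, (i < j)%N -> u i \is t.-homog) ->
  I (yvar j * v - \sum_(i < j) yvar i * u i) ->
  exists2 w : nat -> P, forall i, (i < j)%N -> shomog t (w i)
    & I (v - \sum_(i < j) yvar i * w i).

Lemma ycolonP I q : ycolon I q <->
  forall j t, (j < n)%N -> (q <= t)%N -> colon_at (in_coords A I) j t.
Proof.
split=> col j t jn qt v u hv hu.
  have E (w : nat -> P) (f : P) : in_coords A I (f - \sum_(i < j) var k n i * w i) =
      I (subst A f - \sum_(i < j) yvar i * subst A (w i)).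
    rewrite in_coordsE substB subst_sum.
    by congr (I (_ - _)); apply: eq_bigr => i _; rewrite substM.
  rewrite E substM => Iv.
  have [||//|w hw Iw] := col j t jn qt (subst A v) (fun i => subst A (u i)).
  - exact: subst_homog.
  - by move=> i ij; apply: subst_homog; exact: hu.
  exists (fun i => subst (invmx A) (w i)) => [i ij|].
    by apply: subst_shomog; exact: hw.
  rewrite (E (fun i => subst (invmx A) (w i))) /=.
  by under eq_bigr do rewrite substVK.
move=> Iv; have [|||w hw Iw] := col j t jn qt (subst (invmx A) v) (fun i => subst (invmx A) (u i)).
- exact: subst_homog.
- by move=> i ij; apply: subst_homog; exact: hu.
- rewrite in_coordsE substB substM substVK subst_sum.
  by under eq_bigr do rewrite substM substVK.
exists (fun i => subst A (w i)) => [i ij|]; first by apply: subst_shomog; exact: hw.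
move: Iw; rewrite in_coordsE substB substVK subst_sum.
by under eq_bigr do rewrite substM.
Qed.

(** The empty list is a Pommaret basis of the zero ideal, so the criterion for bases already shows
    that the linear forms are a regular sequence on the polynomial ring. *)
Lemma ycolon0 : ycolon (eq 0) 0.
Proof.
apply/ycolonP => j t jn _.
have zI : homogeneous_ideal (fun f : P => 0 = f).
  split=> // [f g <- <-|f g <-|d f <-]; rewrite ?addr0 ?mulr0 //.
  by rewrite pihomog0.
apply: (@colon_of_pommaret _ _ _ (in_coords_homog A zI) [::] _ 0%N) => //.
split=> // m; split=> [[f [f0 /negP []]]|[] //].
by move: f0; rewrite in_coordsE -[X in X == 0]substK => <-; rewrite subst0.
Qed.

End Coordinates.

(** * Graded submodules of free modules *)

Section GradedFree.

Variables (k : fieldType) (n : nat).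
Local Notation P := {mpoly k[n]}.

(* [grade d s] is the component of degree s - 1 of the free module with basis
   degrees d; as in [shomog], degree -1 is the zero space. *)
Definition grade r (d : 'I_r -> nat) (s : nat) (v : 'rV[P]_r) : Prop :=
  forall c, shomog (s - d c) (v 0 c).

Definition shproj (s : nat) (f : P) : P := if s is e.+1 then pihomog mdeg e f else 0.

Definition gproj r (d : 'I_r -> nat) (s : nat) (v : 'rV[P]_r) : 'rV[P]_r :=
  \row_c shproj (s - d c) (v 0 c).

Lemma shproj_shomog s f : shomog s (shproj s f).
Proof. by case: s => [|s] /=; rewrite ?eqxx ?pihomogP. Qed.

Lemma shproj_id s f : shomog s f -> shproj s f = f.
Proof. by case: s => [/eqP ->|s] //=; exact: pihomog_dE. Qed.

Lemma shproj0 s : shproj s 0 = 0.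
Proof. by case: s => [|s] //=; rewrite pihomog0. Qed.

Lemma shproj_sum s (I : Type) (t : seq I) (Q : pred I) (F : I -> P) :
  shproj s (\sum_(i <- t | Q i) F i) = \sum_(i <- t | Q i) shproj s (F i).
Proof. by case: s => [|s] /=; [rewrite big1 | rewrite raddf_sum]. Qed.

Lemma pihomogM s e (f g : P) : g \is s.-homog ->
  pihomog mdeg (s + e) (f * g) = pihomog mdeg e f * g.
Proof.
move=> hg; have [->|g0] := eqVneq g 0; first by rewrite !mulr0 pihomog0.
pose K := maxn (msize f) e.+1.
have Kf : (msize f <= K)%N by exact: leq_maxl.
have eK : (e < K)%N by exact: leq_maxr.
rewrite {1}(pihomog_partitionE (mf := mdeg) Kf) mulr_suml raddf_sum /=.
have hom (i : nat) : pihomog mdeg i f * g \is (i + s).-homog.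
  by apply: dhomogM => //; exact: pihomogP.
rewrite (bigD1 (Ordinal eK)) //= [(s + e)%N]addnC (pihomog_dE (hom e)).
rewrite big1 ?addr0 // => i ne; apply: pihomog_ne0 (hom i).
by rewrite eqn_add2r.
Qed.

Lemma pihomogM_lt s e (f g : P) : g \is s.-homog -> (e < s)%N -> pihomog mdeg e (f * g) = 0.
Proof.
move=> hg es; rewrite {1}(pihomog_partitionE (mf := mdeg) (leqnn (msize f))) mulr_suml raddf_sum /=.
rewrite big1 // => i _.
have hom : pihomog mdeg i f * g \is (i + s).-homog by apply: dhomogM => //; exact: pihomogP.
by apply: pihomog_ne0 hom; rewrite gtn_eqF // ltn_addl.
Qed.

(** Multiplication by a form of degree d' - d shifts components. Truncated differences stand for
    zero components, hence the case distinctions. *)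
Lemma shprojM s d d' f g : shomog (d'.+1 - d) g ->
  shproj (s - d') f * g = shproj (s - d) (f * g).
Proof.
have [dd'|d'd] := leqP d d'; last first.
  by rewrite (eqP (_ : (d'.+1 - d)%N == 0%N)) // => /eqP ->; rewrite !mulr0 shproj0.
rewrite subSn // => hg; have [sd'|d's] := leqP s d'.
  rewrite (eqP sd') mul0r; case: s sd' => [//|s] sd'.
  have [sd|ds] := leqP s.+1 d; first by rewrite (eqP sd).
  rewrite subSn //= (pihomogM_lt f hg) //.
  by rewrite ltn_sub2r // (leq_trans _ sd').
case: s d's => [//|s] d's.
rewrite !subSn ?(leq_trans dd') //= -(pihomogM _ _ hg).
by rewrite addnC addnBA ?subnK.
Qed.

Section Module.

Variables (r : nat) (d : 'I_r -> nat).

Lemma grade_subgroup s : subgroup (grade d s).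
Proof.
split=> [c|u v Uu Uv c]; rewrite !mxE; first exact: shomog0.
by apply: shomogB.
Qed.

Lemma grade_gproj s v : grade d s (gproj d s v).
Proof. by move=> c; rewrite mxE; exact: shproj_shomog. Qed.

Lemma gproj_id s v : grade d s v -> gproj d s v = v.
Proof. by move=> Uv; apply/rowP => c; rewrite mxE shproj_id. Qed.

Lemma grade_homog_vec e v : grade d e.+1 v <-> homog_vec d e v.
Proof.
have E c : shomog (e.+1 - d c) (v 0 c) =
    if (d c <= e)%N then v 0 c \is (e - d c).-homog else v 0 c == 0.
  case: leqP => dc; first by rewrite subSn.
  by rewrite (eqP (_ : (e.+1 - d c)%N == 0%N)).
by split=> Uv c; move: (Uv c); rewrite E.
Qed.

Lemma sum_gproj v : exists K, v = \sum_(s < K) gproj d s v.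
Proof.
(* Entry c has no component beyond s = d c + msize, as index s means degree s - 1. *)
pose K := (\max_c (d c + msize (v 0%R c)))%N; exists K.+1.
apply/rowP => c; rewrite summxE.
under eq_bigr do rewrite mxE.
have dK : (d c + msize (v 0%R c) <= K)%N by rewrite /K (leq_bigmax c).
have EK : K.+1 = ((d c).+1 + (K - d c))%N.
  by rewrite addSn subnKC // (leq_trans (leq_addr _ _) dK).
rewrite -(big_mkord xpredT (fun s => shproj (s - d c) (v 0 c))) EK big_mkord.
rewrite big_split_ord /= big1 ?add0r => [|i _]; last first.
  by rewrite (eqP (_ : (i - d c)%N == 0%N)) // subn_eq0 -ltnS ltn_ord.
rewrite {1}(pihomog_partitionE (mf := mdeg) (k := K - d c) (p := v 0 c)); last first.
  by rewrite leq_subRL // (leq_trans (leq_addr _ _) dK).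
by apply: eq_bigr => i _; rewrite addSnnS addKn.
Qed.

Definition graded_sub (N : 'rV[P]_r -> Prop) :=
  [/\ N 0, forall u v, N u -> N v -> N (u - v),
      forall a u, N u -> N (a *: u) & forall s v, N v -> N (gproj d s v)].

Definition part (N : 'rV[P]_r -> Prop) s v := grade d s v /\ N v.

Lemma part_subgroup N s : graded_sub N -> subgroup (part N s).
Proof.
case=> N0 NB _ _; have [U0 UB] := grade_subgroup s.
by split=> [|u v [Uu Nu] [Uv Nv]]; split=> //; [exact: UB | exact: NB].
Qed.

End Module.

Lemma gproj_mul r r' (d : 'I_r -> nat) (d' : 'I_r' -> nat) (M : 'M[P]_(r', r)) s w :
  (forall a, grade d (d' a).+1 (row a M)) ->
  gproj d' s w *m M = gproj d s (w *m M).
Proof.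
move=> hM; apply/rowP => c; rewrite !mxE shproj_sum; apply: eq_bigr => a _.
rewrite mxE (@shprojM _ (d c)) //.
by have := hM a c; rewrite mxE.
Qed.

Lemma graded_ker r r' (d : 'I_r -> nat) (d' : 'I_r' -> nat) (M : 'M[P]_(r', r)) :
  (forall a, grade d (d' a).+1 (row a M)) -> graded_sub d' (fun w => w *m M = 0).
Proof.
move=> hM; split=> [|u v uM vM|a u uM|s v vM]; first by rewrite mul0mx.
- by rewrite mulmxBl uM vM subrr.
- by rewrite -scalemxAl uM scaler0.
by rewrite (gproj_mul _ _ hM) vM; apply/rowP => c; rewrite !mxE shproj0.
Qed.

Lemma grade_mul r r' (d : 'I_r -> nat) (d' : 'I_r' -> nat) (M : 'M[P]_(r', r)) s w :
  (forall a, grade d (d' a).+1 (row a M)) -> grade d' s w -> grade d s (w *m M).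
Proof.
by move=> hM Uw; rewrite -(gproj_id Uw) (gproj_mul _ _ hM); exact: grade_gproj.
Qed.

Variable A : 'M[k]_n.
Hypothesis A_unit : A \in unitmx.
Local Notation y := (yvar A).

Lemma yvar_shomog_sub i s e p : shomog (s - e) p -> shomog (s.+1 - e) (y i * p).
Proof.
have [es|se] := leqP e s; first by rewrite subSn //; exact: yvar_shomog.
by rewrite (eqP (ltnW se : (s - e)%N == 0%N)) => /eqP ->; rewrite mulr0 shomog0.
Qed.

Lemma grade_y r (d : 'I_r -> nat) s i v : grade d s v -> grade d s.+1 (y i *: v).
Proof. by move=> Uv c; rewrite mxE; exact: yvar_shomog_sub. Qed.

Lemma part_y r (d : 'I_r -> nat) N s i v :
  graded_sub d N -> part d N s v -> part d N s.+1 (y i *: v).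
Proof. by move=> [_ _ NZ _] [Uv Nv]; split; [exact: grade_y | exact: NZ]. Qed.

(** A free module is a sum of shifted copies of the ring: [ycolon0] applies to entry c in degree t -
    d c, and the entry is 0 if t < d c. *)
Lemma grade_regular r (d : 'I_r -> nat) j t : (j < n)%N ->
  regular_at y (grade d) (@zero_sub _) j t.
Proof.
move=> jn v u Uv Uu /esym/eqP; rewrite subr_eq0 => /eqP Ev.
have comp c : exists w : nat -> P, (forall i, (i < j)%N -> shomog (t - d c) (w i)) /\
    v 0 c = \sum_(i < j) y i * w i.
  have := Uv c; have [dt|td] := leqP (d c) t; last first.
    rewrite (eqP (td : (t.+1 - d c)%N == 0%N)) => /eqP ->.
    by exists (fun=> 0); split=> [i _|]; rewrite ?shomog0 // big1 // => i _; rewrite mulr0.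
  rewrite subSn //= => hv.
  have [||w hw Ew] := @ycolon0 _ _ _ A_unit j (t - d c)%N jn (leq0n _)
    (v 0 c) (fun i => u i 0 c) hv.
  - by move=> i ij; have := Uu i ij c; rewrite subSn.
  - have /rowP /(_ c) := Ev; rewrite summxE mxE => ->.
    by apply/esym/eqP; rewrite subr_eq0; apply/eqP; apply: eq_bigr => i _; rewrite mxE.
  by exists w; split=> //; apply/eqP; rewrite -subr_eq0 -Ew.
have [w hw] := fin_all_exists comp.
exists (fun i => \row_c w c i) => [i ij c|].
  by rewrite mxE; have [h _] := hw c; exact: h.
apply/esym/eqP; rewrite subr_eq0; apply/eqP/rowP => c.
rewrite summxE; have [_ ->] := hw c.
by apply: eq_bigr => i _; rewrite !mxE.
Qed.

Lemma grade_hvanish r (d : 'I_r -> nat) j i t : (j <= n)%N ->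
  hvanish y (grade d) (@zero_sub _) j i.+1 t.
Proof.
move=> jn; apply: (@hvanish_of_regular _ _ _ _ _ _ _ _ _ n 0) => //.
- exact: grade_subgroup.
- exact: subgroup_zero.
- by move=> *; exact: grade_y.
- by move=> s l v <-; rewrite /zero_sub scaler0.
by move=> *; exact: grade_regular.
Qed.

(** An entry of degree 0 equals its constant term and is 0 here; entries of positive degree lie in
    the ideal of the linear forms. *)
Lemma grade_gen r (d : 'I_r -> nat) t v : grade d t.+1 v ->
  (forall c, (v 0 c)@_0%MM = 0) ->
  exists2 w : nat -> 'rV[P]_r, forall i, (i < n)%N -> grade d t (w i)
    & v = \sum_(i < n) y i *: w i.
Proof.
move=> Uv v0.
have comp c : exists w : nat -> P, (forall i, shomog (t - d c) (w i)) /\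
    v 0 c = \sum_(i < n) y i * w i.
  have zero : v 0 c = 0 -> exists w : nat -> P, (forall i, shomog (t - d c) (w i)) /\
      v 0 c = \sum_(i < n) y i * w i.
    by move=> ->; exists (fun=> 0); split=> [i|]; rewrite ?shomog0 // big1 // => i _; rewrite mulr0.
  have := Uv c; have [dt|td] := leqP (d c) t; last first.
    by rewrite (eqP (td : (t.+1 - d c)%N == 0%N)) => /eqP /zero.
  rewrite subSn //= => hv; have [z|nz] := posnP (t - d c)%N; last first.
    have hv' : v 0 c \is (t - d c).-1.+1.-homog by rewrite prednK.
    by have [w hw Ew] := yvar_gen A_unit hv'; exists w; rewrite prednK in hw.
  apply: zero; apply/mpolyP => m; rewrite mcoeff0.
  have [->//|m0] := eqVneq m 0%MM; apply: (dhomog_nemf_coeff hv).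
  by rewrite z mdeg_eq0.
have [w hw] := fin_all_exists comp.
exists (fun i => \row_c w c i) => [i ij c|].
  by rewrite mxE; have [h _] := hw c; exact: h.
apply/rowP => c; rewrite summxE; have [_ ->] := hw c.
by apply: eq_bigr => i _; rewrite !mxE.
Qed.

End GradedFree.

(** * Minimal generators *)

(** S is an arbitrary predicate, so the family is obtained classically: a vector of S outside the
    row space of B is appended as long as one exists, and the rank bounds the number of times. *)
Lemma subspace_span (k : fieldType) D (S : 'rV[k]_D -> Prop) :
  exists m (B : 'M[k]_(m, D)), (forall i, S (row i B)) /\ forall v, S v -> (v <= B)%MS.
Proof.
suff grow c : forall m (B : 'M[k]_(m, D)), (forall i, S (row i B)) ->
    (D - \rank B <= c)%N ->
    exists m (B : 'M[k]_(m, D)), (forall i, S (row i B)) /\ forall v, S v -> (v <= B)%MS.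
  by apply: (grow D 0%N 0) => [[]|]; rewrite ?leq_subr.
elim: c => [|c IH] m B SB rB.
  exists m, B; split=> // v _; apply: submx_full.
  by rewrite /row_full eqn_leq rank_leq_col -subn_eq0 -leqn0.
case: (classic (forall v, S v -> (v <= B)%MS)) => [max|]; first by exists m, B.
move/not_all_ex_not => [v /(imply_to_and (S v)) [Sv /negP nvB]].
apply: (IH (m + 1)%N (col_mx B v)) => [i|].
  case: (splitP i) => j E.
    have -> : i = lshift 1 j by exact: val_inj.
    by rewrite rowKu.
  have -> : i = rshift m j by exact: val_inj.
  by rewrite rowKd row_id.
rewrite leq_subLR (leq_trans _ (_ : \rank B + 1 + c <= _)%N) //; last first.
  rewrite leq_add2r addn1 rank_ltmx // ltmxE col_mx_sub (negbTE nvB) andbF andbT.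
  by have := submx_refl (col_mx B v); rewrite col_mx_sub => /andP [].
by rewrite -addnA add1n -leq_subLR.
Qed.

Section Generators.

Variables (k : fieldType) (n : nat).
Local Notation P := {mpoly k[n]}.

Definition spanned r r' (M : 'M[P]_(r', r)) (v : 'rV[P]_r) : Prop :=
  exists w, v = w *m M.

Lemma spannedD r r' (M : 'M[P]_(r', r)) u v :
  spanned M u -> spanned M v -> spanned M (u + v).
Proof. by move=> [a ->] [b ->]; exists (a + b); rewrite mulmxDl. Qed.

Lemma spannedZ r r' (M : 'M[P]_(r', r)) a u : spanned M u -> spanned M (a *: u).
Proof. by move=> [b ->]; exists (a *: b); rewrite scalemxAl. Qed.

Lemma spanned0 r r' (M : 'M[P]_(r', r)) : spanned M 0.
Proof. by exists 0; rewrite mul0mx. Qed.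

Lemma spanned_sum r r' (M : 'M[P]_(r', r)) (I : Type) (s : seq I) (Q : pred I) F :
  (forall i, Q i -> spanned M (F i)) -> spanned M (\sum_(i <- s | Q i) F i).
Proof.
by move=> sF; apply: big_ind => //; [exact: spanned0 | move=> u v; exact: spannedD].
Qed.

Variables (r : nat) (d : 'I_r -> nat) (N : 'rV[P]_r -> Prop).
Hypothesis N_graded : graded_sub d N.

Lemma shomog_sumC s m (c : 'I_m -> k) (F : 'I_m -> P) :
  (forall i, shomog s (F i)) -> shomog s (\sum_i (c i)%:MP * F i).
Proof.
case: s => [|s] hF /=.
  by rewrite big1 // => i _; have /eqP -> := hF i; rewrite mulr0.
by apply: rpred_sum => i _; rewrite mul_mpolyC; apply: dhomogZ; exact: hF.
Qed.

Lemma degree_generators t : exists r' (M : 'M[P]_(r', r)),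
  (forall a, part d N t.+1 (row a M)) /\ forall v, part d N t.+1 v -> spanned M v.
Proof.
pose T := ('I_r * 'X_{1..n < t.+1})%type.
(* Coefficients up to degree t determine a vector of degree t, so each component of N sits in a
   finite-dimensional space. *)
pose coords (v : 'rV[P]_r) : 'rV[k]_#|{: T}| :=
  \row_i (v 0 (enum_val i).1)@_(val (enum_val i).2).
have [m [B [SB gen]]] :=
  subspace_span (fun x => exists2 v, part d N t.+1 v & coords v = x).
have [g hg gB] := fin_all_exists2 SB.
exists m, (\matrix_i g i); split=> [a|v [Uv Nv]].
  by rewrite rowK; exact: hg.
have /gen /submxP [D ED] : exists2 u, part d N t.+1 u & coords u = coords v.
  by exists v.
exists (map_mx (@mpolyC n k) D); apply/eqP; rewrite -subr_eq0; apply/eqP/rowP => c.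
rewrite !mxE.
have hd : shomog (t.+1 - d c) (v 0 c - \sum_j (map_mx (@mpolyC n k) D) 0 j * (\matrix_i g i) j c).
  apply: shomogB; first exact: Uv.
  under eq_bigr do rewrite !mxE.
  apply: shomog_sumC => i; have [Ug _] := hg i; exact: Ug.
apply/mpolyP => mu; rewrite mcoeff0.
have [lt|ge] := ltnP (mdeg mu) t.+1; last first.
  move: hd; have [dt|td] := leqP (d c) t; last first.
    by rewrite (eqP (td : (t.+1 - d c)%N == 0%N)) => /eqP ->; rewrite mcoeff0.
  rewrite subSn // => hd; apply: (dhomog_nemf_coeff hd).
  by rewrite gtn_eqF // (leq_ltn_trans (leq_subr _ _) ge).
pose e : T := (c, BMultinom lt).
have := congr1 (fun x : 'rV[k]_#|{: T}| => x 0 (enum_rank e)) ED.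
rewrite !mxE enum_rankK /= => Ev.
rewrite mcoeffB Ev raddf_sum -sumrB big1 //= => j _.
rewrite !mxE mcoeffCM.
have := congr1 (fun x : 'rV[k]_#|{: T}| => x 0 (enum_rank e)) (gB j).
by rewrite !mxE enum_rankK /= => ->; rewrite subrr.
Qed.

Lemma bounded_generators b : exists r' (d' : 'I_r' -> nat) (M : 'M[P]_(r', r)),
  [/\ forall a, (d' a < b)%N, forall a, part d N (d' a).+1 (row a M)
    & forall t v, (t < b)%N -> part d N t.+1 v -> spanned M v].
Proof.
elim: b => [|b [r1 [d1 [M1 [lt1 part1 gen1]]]]].
  by exists 0%N, (fun=> 0%N), 0; split=> // -[].
have [r2 [M2 [part2 gen2]]] := degree_generators b.
exists (r1 + r2)%N, (fun a => if split a is inl a1 then d1 a1 else b), (col_mx M1 M2).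
split=> [a|a|t v].
- by case: split => [a1|//]; exact: ltnW (lt1 a1).
- case: (splitP a) => a' E.
    have -> : a = lshift r2 a' by exact: val_inj.
    by rewrite rowKu.
  have -> : a = rshift r1 a' by exact: val_inj.
  by rewrite rowKd.
rewrite ltnS leq_eqVlt => /orP [/eqP ->|tb] vN.
  by have [w ->] := gen2 v vN; exists (row_mx 0 w); rewrite mul_row_col mul0mx add0r.
by have [w ->] := gen1 t v tb vN; exists (row_mx w 0); rewrite mul_row_col mul0mx addr0.
Qed.

Definition generators b r' (d' : 'I_r' -> nat) (M : 'M[P]_(r', r)) : Prop :=
  [/\ forall a, (d' a <= b)%N, forall a, part d N (d' a).+1 (row a M)
    & forall v, N v -> spanned M v].

Lemma mulmx_row' r1 (M : 'M[P]_(r1.+1, r)) (w : 'rV[P]_r1.+1) a :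
  w *m M = w 0 a *: row a M + col' a w *m row' a M.
Proof.
rewrite !mulmx_sum_row (bigD1_ord a) //=; congr (_ + _); apply: eq_bigr => i _.
by rewrite !mxE; congr (_ *: _); apply/rowP => c; rewrite !mxE.
Qed.

Section Nakayama.

Variables (y : nat -> P) (b : nat).
Hypothesis high : forall t v, (b < t)%N -> part d N t.+1 v ->
  exists2 w : nat -> 'rV[P]_r, forall i, (i < n)%N -> part d N t (w i)
    & v = \sum_(i < n) y i *: w i.

(** Above degree b every element is a combination of elements of lower degree, so generators of the
    finitely many degrees up to b suffice. *)
Lemma finite_generators : exists r' d' (M : 'M[P]_(r', r)), generators b d' M.
Proof.
have [r' [d' [M [lt partM gen]]]] := bounded_generators b.+1.
have N_spanned t (v : 'rV[P]_r) : part d N t v -> spanned M v.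
  elim: t v => [|t IH] v vN.
    suff -> : v = 0 by exact: spanned0.
    by apply/rowP => c; have [/(_ c) /eqP ->] := vN; rewrite mxE.
  have [/gen gen_t|bt] := leqP t b; first exact: gen_t.
  have [w hw ->] := high bt vN; apply: spanned_sum => i _.
  by apply: spannedZ; apply: IH; exact: hw.
exists r', d', M; split=> // v Nv; have [K ->] := sum_gproj d v.
apply: spanned_sum => s _; apply: (N_spanned s); split; first exact: grade_gproj.
by case: N_graded => _ _ _; exact.
Qed.

(** In a family with the fewest members no relation has a constant term: it would express one
    generator by the others. *)
Lemma minimal_generators : exists r' d' (M : 'M[P]_(r', r)),
  generators b d' M /\ forall w : 'rV[P]_r', w *m M = 0 -> forall a, (w 0 a)@_0%MM = 0.
Proof.
have [r0 ex0] : exists r', exists d' (M : 'M[P]_(r', r)), generators b d' M.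
  by have [r' [d' [M gM]]] := finite_generators; exists r', d', M.
elim/ltn_ind: r0 ex0 => r1 IH [d1 [M1 gM]].
case: (classic (exists2 w : 'rV[P]_r1, w *m M1 = 0 & exists a, (w 0 a)@_0%MM != 0)); last first.
  move=> no; exists r1, d1, M1; split=> // w wM a; apply/eqP/negPn/negP => wa.
  by case: no; exists w => //; exists a.
case=> w0 w0M [a]; case: r1 d1 M1 w0 a gM w0M IH => [|r1] d1 M1 w0 a; first by case: a.
move=> [le1 part1 gen1] w0M IH w0a.
apply: (IH r1) => //; exists (fun i => d1 (lift a i)), (row' a M1).
have partM i : part d N (d1 (lift a i)).+1 (row i (row' a M1)).
  have -> : row i (row' a M1) = row (lift a i) M1 by apply/rowP => c; rewrite !mxE.
  exact: part1.
split=> // v Nv; have [u ->] := gen1 v Nv.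
have hM i : grade d (d1 i).+1 (row i M1) by case: (part1 i).
(* In the component of degree d1 a of the relation, the coefficient of row a is a constant, hence
   invertible. *)
pose w := gproj d1 (d1 a).+1 w0.
have wM : w *m M1 = 0.
  by rewrite /w (gproj_mul _ _ hM) w0M; apply/rowP => c; rewrite !mxE shproj0.
have [c c0 wa] : exists2 c, c != 0 & w 0 a = c%:MP.
  exists ((w0 0 a)@_0%MM) => //; rewrite mxE subSn // subnn /=.
  apply/mpolyP => m; rewrite mcoeff_pihomog mcoeffC mdeg_eq0.
  by case: eqP => [->|_]; rewrite ?mulr1 ?mulr0.
have rowa : row a M1 = - (c^-1)%:MP *: (col' a w *m row' a M1).
  move/eqP: wM; rewrite (mulmx_row' _ _ a) wa addr_eq0 => /eqP E.
  rewrite scaleNr -scalerN -E scalerA -mpolyCM mulVf // mpolyC1 scale1r //.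
rewrite (mulmx_row' _ _ a) rowa; apply: spannedD; last by eexists.
by do 2![apply: spannedZ]; eexists.
Qed.

End Nakayama.

End Generators.

(** * Minimal resolutions *)

Section Syzygies.

Variables (k : fieldType) (n : nat) (A : 'M[k]_n).
Hypothesis A_unit : A \in unitmx.
Local Notation P := {mpoly k[n]}.
Local Notation y := (yvar A).

Lemma part_grade r (d : 'I_r -> nat) (N : 'rV[P]_r -> Prop) t v :
  part d N t v -> grade d t v.
Proof. by case. Qed.

Lemma subgroupD (V : lmodType P) (S : V -> Prop) u v :
  subgroup S -> S u -> S v -> S (u + v).
Proof. by move=> [S0 SB] Su Sv; rewrite -[v]opprK -[- v]add0r; apply: (SB) => //; exact: SB. Qed.

Lemma subgroup_sum (V : lmodType P) (S : V -> Prop) m (F : 'I_m -> V) :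
  subgroup S -> (forall i, S (F i)) -> S (\sum_i F i).
Proof.
move=> Sg SF; apply: (big_ind S) => [|u v|i _]; [by case: Sg | exact: subgroupD | exact: SF].
Qed.

Lemma graded_sub_mul r (d : 'I_r -> nat) N r' (M : 'M[P]_(r', r)) w :
  graded_sub d N -> (forall a, N (row a M)) -> N (w *m M).
Proof.
move=> [N0 NB NZ _] NM; rewrite mulmx_sum_row.
by apply: subgroup_sum => // a; exact: NZ.
Qed.

(** M maps the free module onto N with kernel K, so N can be replaced by the free module modulo
    K. *)
Lemma hvanish_cover r (d : 'I_r -> nat) (N : 'rV[P]_r -> Prop)
    r' (d' : 'I_r' -> nat) (M : 'M[P]_(r', r)) (K : 'rV[P]_r' -> Prop) i t :
  (forall a, grade d (d' a).+1 (row a M)) ->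
  (forall v, N v <-> exists w, v = w *m M) ->
  (forall w, K w <-> w *m M = 0) ->
  hvanish y (grade d') (part d' K) n i t <->
  hvanish y (part d N) (@zero_sub _) n i t.
Proof.
move=> hM NM KM; apply: (@hvanish_iso _ _ _ _ (mulmx^~ M)) => //.
- by move=> a u v; rewrite mulmxDl scalemxAl.
- by move=> s w Uw; split; [exact: grade_mul hM Uw | apply/NM; exists w].
- move=> s v [Uv /NM [w E]]; exists (gproj d' s w); first exact: grade_gproj.
  by rewrite (gproj_mul _ _ hM) -E gproj_id.
- move=> s w Uw; split=> [[_ /KM ->] //|E].
  by split=> //; apply/KM; rewrite -E.
- exact: grade_subgroup.
by move=> *; exact: grade_y.
Qed.

(** For i > 0 the free module has no homology; for i = 0 the absence of constant terms puts N inside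
    the multiples of the linear forms. *)
Lemma cycles_bound_grade r (d : 'I_r -> nat) (N : 'rV[P]_r -> Prop) t :
  graded_sub d N ->
  (forall v, part d N t.+1 v -> forall c, (v 0 c)@_0%MM = 0) ->
  forall i, cycles_bound y (grade d) (part d N) n i t.+1.
Proof.
move=> gN N0 [|i]; last first.
  apply: cycles_bound_hvanish; last exact: grade_hvanish.
  by move=> s v; exact: part_grade.
apply: cycles_bound0.
- exact: grade_subgroup.
- by move=> s; exact: part_subgroup.
by move=> v Nv; apply: grade_gen => //; [exact: part_grade Nv | exact: N0].
Qed.

Lemma grade_coef0 r (d : 'I_r -> nat) t v c :
  grade d t.+1 v -> (d c < t)%N -> (v 0 c : P)@_0%MM = 0.
Proof.
move=> Uv dt; have := Uv c; rewrite subSn; last exact: ltnW.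
move=> hv; apply: (dhomog_nemf_coeff hv).
by apply: contraTneq dt => E; rewrite -leqNgt -subn_eq0 -E; apply/eqP; exact: mdeg0.
Qed.

(** For i = 0 this says that N is generated in degrees up to b; the higher i propagate the bound to
    the syzygies. *)
Definition vanishes_above r (d : 'I_r -> nat) (N : 'rV[P]_r -> Prop) b : Prop :=
  graded_sub d N /\
  forall i t, (b < t)%N -> hvanish y (part d N) (@zero_sub _) n i t.

(** H_i of the kernel in entry degree t + 1 comes from H_(i+1) of N in entry degree t, which is why
    the bound grows by one. *)
Lemma syzygy_step r (d : 'I_r -> nat) (N : 'rV[P]_r -> Prop) b :
  vanishes_above d N b ->
  exists r' (d' : 'I_r' -> nat) (M : 'M[P]_(r', r)),
    [/\ generators d N b d' M,
        forall w : 'rV[P]_r', w *m M = 0 -> forall a, (w 0 a)@_0%MM = 0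
      & vanishes_above d' (fun w => w *m M = 0) b.+1].
Proof.
move=> [gN van]; have [|r' [d' [M [[le partM gen] min]]]] := @minimal_generators _ _ _ _ _ gN y b.
  move=> t v bt Nv.
  have gen := iffLR (hvanish00P _ (fun s => part_subgroup s gN)
    (fun s => subgroup_zero _ s) n t) (van 0%N t bt).
  have [w hw /esym/eqP] := gen v Nv.
  by rewrite subr_eq0 => /eqP E; exists w.
have hM a : grade d (d' a).+1 (row a M) by exact: part_grade (partM a).
exists r', d', M; split=> //; split; first exact: graded_ker hM.
move=> i [//|t] bt; apply: hvanish_sub.
  by apply: cycles_bound_grade; [exact: graded_ker hM | move=> v [_ /min]].
rewrite (@hvanish_cover _ d N _ _ M) //; first exact: van.
move=> v; split=> [/gen //|[w ->]].
by apply: graded_sub_mul gN _ => a; case: (partM a).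
Qed.

(** The fields of a resolution are functions of i, so the choices of [syzygy_step] must be iterated
    as a function; [bounded_stage] carries along the vanishing that permits the next step. *)
Record stage := Stage {
  st_rank : nat;
  st_deg : 'I_st_rank -> nat;
  st_sub : 'rV[P]_st_rank -> Prop }.

Definition bounded_stage :=
  {x : nat * stage | vanishes_above (@st_deg x.2) (@st_sub x.2) x.1}.

Lemma bounded_stage_step (x : bounded_stage) :
  exists sM : {s : stage & 'M[P]_(st_rank s, st_rank (sval x).2)},
    [/\ generators (@st_deg (sval x).2) (@st_sub (sval x).2) (sval x).1
          (@st_deg (tag sM)) (tagged sM),
        forall w : 'rV[P]_(st_rank (tag sM)),
          w *m tagged sM = 0 -> forall a, (w 0 a)@_0%MM = 0,
        forall w, @st_sub (tag sM) w <-> w *m tagged sM = 0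
      & vanishes_above (@st_deg (tag sM)) (@st_sub (tag sM)) (sval x).1.+1].
Proof.
case: x => -[b [r d N]] /= /syzygy_step [r' [d' [M [gM min van]]]].
by exists (Tagged (fun s : stage => 'M[P]_(st_rank s, r))
  (M : 'M[P]_(st_rank (@Stage r' d' (fun w => w *m M = 0)), r))).
Qed.

Definition next (x : bounded_stage) :=
  constructive_indefinite_description _ (bounded_stage_step x).

Lemma next_bounded (x : bounded_stage) :
  let y := ((sval x).1.+1, tag (sval (next x))) in
  vanishes_above (@st_deg y.2) (@st_sub y.2) y.1.
Proof. by case: (next x) => sM []. Qed.

Definition succ_stage (x : bounded_stage) : bounded_stage :=
  exist _ ((sval x).1.+1, tag (sval (next x))) (next_bounded x).

Lemma succ_stage_bound x i : (sval (iter i succ_stage x)).1 = ((sval x).1 + i)%N.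
Proof. by elim: i => [|i IH]; rewrite ?addn0 //= IH addnS. Qed.

Variable I : P -> Prop.
Hypothesis I_homog : homogeneous_ideal I.

(** The ideal becomes a graded submodule of the free module of rank one, with basis in degree 0. *)
Definition deg0 (c : 'I_1) : nat := 0.
Definition ideal_sub (v : 'rV[P]_1) : Prop := I (v 0 0).

Lemma ideal_sub_graded : graded_sub deg0 ideal_sub.
Proof.
split; rewrite /ideal_sub.
- by rewrite mxE; exact: (hideal0 I_homog).
- by move=> u v Iu Iv; rewrite !mxE; exact: idealB.
- by move=> a u Iu; rewrite mxE; exact: (hidealM I_homog).
move=> [|s] v Iv; rewrite mxE ?subn0 /=; first exact: (hideal0 I_homog).
exact: (hideal_component I_homog).
Qed.

Lemma ycolon_regular q : ycolon A I q <->
  forall j t, (j < n)%N -> (q <= t)%N ->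
    regular_at y (grade deg0) (part deg0 ideal_sub) j t.
Proof.
split=> col j t jn qt v u hv hu.
  move=> [_]; rewrite /ideal_sub !mxE summxE.
  under eq_bigr do rewrite mxE.
  move=> /(col j t jn qt (v 0 0) (fun i => u i 0 0)) [|i ij|w hw Iw].
  - by have := hv 0; rewrite subn0.
  - by have := hu i ij 0; rewrite subn0.
  exists (fun i => (w i)%:M) => [i ij c|].
    by rewrite mxE subn0 !ord1 /=; exact: hw.
  have Uw i : (i < j)%N -> grade deg0 t.+1 (y i *: (w i)%:M).
    by move=> ij; apply: grade_y => c; rewrite mxE subn0 !ord1; exact: hw.
  split; last by rewrite /ideal_sub !mxE summxE; under eq_bigr do rewrite !mxE.
  have Ug := @grade_subgroup k n _ deg0 t.+1; have [_ UB] := Ug; apply: (UB) => //.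
  by apply: subgroup_sum => // i; exact: Uw.
move=> Iv.
have gr p : p \is t.-homog -> grade deg0 t.+1 (p%:M : 'rV[P]_1).
  by move=> hp_p c; rewrite mxE subn0 !ord1.
have [|i ij||w hw [_ Iw]] := col j t jn qt v%:M (fun i => (u i)%:M).
- exact: gr.
- by apply: gr; exact: hu.
- split; last by rewrite /ideal_sub !mxE summxE; under eq_bigr do rewrite !mxE.
  have Ug := @grade_subgroup k n _ deg0 t.+2; have [_ UB] := Ug; apply: (UB).
    by apply: grade_y; exact: gr.
  by apply: subgroup_sum => // i; apply: grade_y; apply: gr; exact: hu.
exists (fun i => w i 0 0) => [i ij|]; first by have := hw i ij 0; rewrite subn0.
by move: Iw; rewrite /ideal_sub !mxE summxE; under eq_bigr do rewrite mxE.
Qed.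

Lemma ideal_vanishes_above q : ycolon A I q -> vanishes_above deg0 ideal_sub q.
Proof.
move=> /ycolon_regular reg; split; first exact: ideal_sub_graded.
move=> i [//|t] qt; apply: hvanish_sub.
  (* The elements concerned have degree t + 1 > 0 and thus no constant term, even if I is the unit
     ideal. *)
  apply: cycles_bound_grade; first exact: ideal_sub_graded.
  by move=> v [Uv _] c; apply: grade_coef0 Uv _.
apply: (@hvanish_of_regular _ _ _ _ _ _ _ _ _ n q) => //.
- exact: grade_subgroup.
- by move=> s; apply: part_subgroup; exact: ideal_sub_graded.
- by move=> *; exact: grade_y.
by move=> *; apply: part_y => //; exact: ideal_sub_graded.
Qed.

(** A homogeneous vector of degree below d a has entry a equal to 0, so such vectors cannot produce
    the basis vector a. *)
Lemma generated_in_degree_leP r (d : 'I_r -> nat) m :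
  generated_in_degree_le k n d m <-> forall a, (d a <= m)%N.
Proof.
split=> [gen a|le v]; last first.
  exists r, 1%:M, v; split; last by rewrite mulmx1.
  move=> a; exists (d a) => // c; rewrite !mxE.
  case: eqVneq => [<-|_]; first by rewrite leqnn subnn mulr1n dhomog1.
  by rewrite mulr0n; case: leqP => _; rewrite ?eqxx ?dhomog0.
have [s [G [c [hG E]]]] := gen (delta_mx 0 a).
rewrite leqNgt; apply/negP => ma.
have /rowP /(_ a) := E; rewrite !mxE !eqxx big1 => [/eqP|b _].
  by rewrite oner_eq0.
have [e em /(_ a)] := hG b; rewrite leqNgt (leq_ltn_trans em ma) /= mxE => /eqP ->.
by rewrite mulr0.
Qed.

Lemma ycolon_q_regular q : ycolon A I q -> q_regular I q.
Proof.
move=> /ideal_vanishes_above van.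
pose x0 : bounded_stage :=
  exist (fun x : nat * stage => vanishes_above (@st_deg x.2) (@st_sub x.2) x.1)
        (q, @Stage 1 deg0 ideal_sub) van.
pose x i := iter i succ_stage x0.
pose M i := tagged (sval (next (x i))).
have genM i : generators (@st_deg (sval (x i)).2) (@st_sub (sval (x i)).2) (q + i)
    (@st_deg (sval (x i.+1)).2) (M i).
  have <- : (sval (x i)).1 = (q + i)%N := succ_stage_bound x0 i.
  by have [g _ _ _] := svalP (next (x i)); exact: g.
have minM i (w : 'rV[P]_(st_rank (sval (x i.+1)).2)) : w *m M i = 0 -> forall a, (w 0 a)@_0%MM = 0.
  by have [_ min _ _] := svalP (next (x i)); exact: min.
have subM i w : @st_sub (sval (x i.+1)).2 w <-> w *m M i = 0.
  by have [_ _ sub _] := svalP (next (x i)); exact: sub.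
have spanM i v : @st_sub (sval (x i)).2 v <-> exists w, v = w *m M i.
  have [_ partM gen] := genM i; split=> [/gen //|[w ->]].
  have [gN _] := svalP (x i).
  by apply: graded_sub_mul gN _ => a; case: (partM a).
have F : {F : minimal_graded_free_resolution I |
    forall i a, (fr_deg (m := F) (i := i) a <= q + i)%N}.
  unshelve eexists.
    apply: (@MinimalGradedFreeResolution _ _ I
      (fun i => st_rank (sval (x i.+1)).2) (fun i => @st_deg (sval (x i.+1)).2)
      (M 0%N) (fun i => M i.+1)).
  - move=> a; have [_ /(_ a) [/(_ 0) + _] _] := genM 0%N.
    by rewrite mxE subn0.
  - move=> i a; have [_ /(_ a) [+ _] _] := genM i.+1.
    by move/grade_homog_vec.
  - move=> f; split=> [If|[v ->]].
      have /(spanM 0%N) [w E] : ideal_sub f%:M by rewrite /ideal_sub mxE.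
      by exists w; rewrite -E mxE.
    by have : ideal_sub (v *m M 0%N) by apply/(spanM 0%N); exists v.
  - by move=> v; rewrite -(subM 0%N) (spanM 1%N).
  - by move=> i v; rewrite -(subM i.+1) (spanM i.+2).
  (* The rows of [M i.+1] are relations among the rows of [M i], which form a minimal family. *)
  - move=> i a b; have := @minM i (row a (M i.+1)) _ b; rewrite mxE; apply.
    by apply/subM; have [_ /(_ a) []] := genM i.+1.
  by move=> i a /=; have [] := genM i.
by exists (sval F) => i; apply/generated_in_degree_leP; exact: (svalP F).
Qed.

(** [F_i] modulo the image of [F_(i+1)] is the i-th syzygy module, and the basis degrees control its
    H_0. The bound q, possibly larger than q', provides the degrees in which the descent starts. *)
Lemma q_regular_ycolon q q' : ycolon A I q -> q_regular I q' -> ycolon A I q'.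
Proof.
move=> /ycolon_regular reg [F Fq]; apply/ycolon_regular.
have gI := ideal_sub_graded.
pose im i (v : 'rV[P]_(fr_rank F i)) := exists w, v = w *m fr_map F i.
have hmap i a : grade (@fr_deg _ _ _ F i) (fr_deg a).+1 (row a (fr_map F i)).
  by apply/grade_homog_vec; exact: fr_map_homog.
have gim i : graded_sub (@fr_deg _ _ _ F i) (im i).
  split; first by exists 0; rewrite mul0mx.
  - by move=> _ _ [u ->] [v ->]; exists (u - v); rewrite mulmxBl.
  - by move=> a _ [u ->]; exists (a *: u); rewrite scalemxAl.
  by move=> s _ [u ->]; exists (gproj (@fr_deg _ _ _ F i.+1) s u); rewrite (gproj_mul _ _ (hmap i)).
(* Induction on l for all i at once: H_(l+1) of a syzygy module comes from H_l of the next one. *)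
have van l : forall i t, (q' + i < t)%N ->
    hvanish y (grade (@fr_deg _ _ _ F i)) (part (@fr_deg _ _ _ F i) (im i)) n l t.
  elim: l => [|l IH] i t qt.
    apply/hvanish00P.
    - exact: grade_subgroup.
    - by move=> s; exact: part_subgroup.
    move=> v Uv; have [|w hw ->] := grade_gen A_unit Uv.
      move=> c; apply: grade_coef0 Uv _; apply: leq_ltn_trans qt.
      by move: c; apply/generated_in_degree_leP.
    exists w => //; rewrite subrr; have [] := part_subgroup t.+1 (gim i); by [].
  apply: hvanish_quotient.
  - exact: grade_subgroup.
  - by move=> s v; exact: part_grade.
  - rewrite -(@hvanish_cover _ _ _ _ _ (fr_map F i) (im i.+1)) //.
      by apply: IH; rewrite addnS ltnS.
    by move=> w; rewrite fr_exact.
  exact: grade_hvanish.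
apply: regular_of_hvanish.
- exact: grade_subgroup.
- by move=> s; exact: part_subgroup.
- by move=> *; exact: grade_y.
- by move=> *; exact: part_y.
- exact: reg.
move=> l t qt; apply: hvanish_quotient.
- exact: grade_subgroup.
- by move=> s v; exact: part_grade.
- rewrite -(@hvanish_cover _ _ _ _ (@fr_deg _ _ _ F 0) (fr_aug F) (im 0%N)).
  + by apply: van; rewrite addn0 ltnS.
  + move=> a c; rewrite ord1 mxE subn0; exact: fr_aug_homog.
  + move=> v; rewrite /ideal_sub (fr_aug_image F); split=> -[w E]; exists w.
      by apply/rowP => c; rewrite ord1.
    by rewrite E.
  by move=> w; rewrite fr_exact0.
exact: grade_hvanish.
Qed.

End Syzygies.

(** * Regularity as the degree of a Pommaret basis *)

Lemma regularity_of_pommaret (k : fieldType) (n : nat) (I : {mpoly k[n]} -> Prop)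
    (A : 'M[k]_n) (H : seq {mpoly k[n]}) :
  homogeneous_ideal I -> A \in unitmx -> pommaret_basis (in_coords A I) H ->
  castelnuovo_mumford_regularity I (basis_degree H).
Proof.
move=> hI uA pH; have hJ := in_coords_homog A hI.
have col : ycolon A I (basis_degree H).
  apply/(ycolonP uA); apply: (colon_of_pommaret hJ pH) => h hH.
  have [_ h0] := pommaret_sub pH hH.
  rewrite mdeg_drl_lead // /basis_degree.
  exact: (@leq_bigmax_seq _ _ xpredT (fun h => (msize h).-1)).
split; first exact: ycolon_q_regular col.
move=> q' /(q_regular_ycolon uA hI col) /(ycolonP uA) col'.
apply/bigmax_leqP_seq => h hH _; have [_ h0] := pommaret_sub pH hH.
by rewrite -mdeg_drl_lead //; apply: (pommaret_of_colon hJ pH col').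
Qed.

(** Cutting each element down to its component in the degree of the leading exponent keeps it in J
    and keeps that exponent, on which the cones depend. *)
Lemma pommaret_homog (k : fieldType) (n : nat) (J : {mpoly k[n]} -> Prop)
    (H : seq {mpoly k[n]}) :
  homogeneous_ideal J -> pommaret_basis J H ->
  let top h := pihomog mdeg (mdeg (drl_lead h)) h in
  pommaret_basis J [seq top h | h <- H].
Proof.
move=> hJ pH top.
have topP h : h \in H -> top h != 0 /\ drl_lead (top h) = drl_lead h.
  by move=> /(pommaret_sub pH) [_ /drl_lead_pihomog].
split.
- move=> _ /mapP [h hH ->]; have [Jh h0] := pommaret_sub pH hH.
  by split; [exact: (hideal_component hJ) | have [] := topP h hH].
- move=> _ _ /mapP [h1 H1 ->] /mapP [h2 H2 ->].
  have [_ ->] := topP h1 H1; have [_ ->] := topP h2 H2.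
  by move/(pommaret_inj pH H1 H2) ->.
- move=> m; rewrite (pommaret_cover pH); split=> [[h hH]|[_ /mapP [h hH ->]]].
    by have [_ E] := topP h hH; exists (top h); rewrite ?E ?map_f.
  by have [_ ->] := topP h hH; exists h.
move=> _ _ /mapP [h1 H1 ->] /mapP [h2 H2 ->] ne m.
have [_ ->] := topP h1 H1; have [_ ->] := topP h2 H2.
by apply: (pommaret_disjoint pH H1 H2); apply: contraNneq ne => ->.
Qed.

Theorem theorem9p2 (k : fieldType) (n : nat) (I : {mpoly k[n]} -> Prop)
    (I_homog : homogeneous_ideal I)
    (I_nonzero : exists2 f : {mpoly k[n]}, I f & f != 0)
    (k_large : exists (A : 'M[k]_n) (H : seq {mpoly k[n]}),
      A \in unitmx /\ pommaret_basis (in_coords A I) H)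
    (q : nat) :
  castelnuovo_mumford_regularity I q <->
  exists (A : 'M[k]_n) (H : seq {mpoly k[n]}),
    [/\ A \in unitmx,
        pommaret_basis (in_coords A I) H,
        (forall h : {mpoly k[n]}, h \in H -> h \is homog mdeg)
      & basis_degree H = q].
Proof.
split=> [[regq minq]|[A [H [uA pH _ <-]]]]; last exact: regularity_of_pommaret uA pH.
have [A [H [uA pH]]] := k_large.
have pH' := pommaret_homog (in_coords_homog A I_homog) pH.
have [regH minH] := regularity_of_pommaret I_homog uA pH'.
exists A, [seq pihomog mdeg (mdeg (drl_lead h)) h | h <- H]; split=> //.
  by move=> _ /mapP [h _ ->]; apply: homogE; exact: pihomogP.
by apply/eqP; rewrite eqn_leq minH // minq.
Qed.
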